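(* Let $k\ge1$ be an integer, let $0<c_1\le c_2$, and let $Q$ be an infinite set of prime powers. For each $q\in Q$ let $P_q\in\mathbb F_q[x_1,x_2,x_3]$ be a homogeneous polynomial of degree $k$, and let $H_q=\{x\in\mathbb F_q^3:P_q(x)=0\}$. Assume that for every $q\in Q$ we have $c_1q^2\le|H_q|\le c_2q^2$ and $H_q$ does not contain any plane passing through the origin. Let $1\le p,r\le\infty$, and let $A_q(p\to r)$ denote the smallest constant such that $$\|f\ast d\sigma_q\|_{L^r(\mathbb F_q^3,dx)}\le A_q(p\to r)\,\|f\|_{L^p(\mathbb F_q^3,dx)}\quad\text{for all } f:\mathbb F_q^3\to\mathbb C,$$ where $d\sigma_q$ is the normalized surface measure on $H_q$. Then $A_q(p\to r)\lesssim 1$ (i.e. $\sup_{q\in Q}A_q(p\to r)<\infty$) if and only if $(1/p,1/r)$ is contained in the convex hull of the points $(0,0),(0,1),(1,1),(3/4,1/4)$.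
   Context: $\mathbb F_q$ is the finite field with $q$ elements, and $|\cdot|$ of a finite set denotes its cardinality. A polynomial is homogeneous of degree $k$ if all its monomials with nonzero coefficients have total degree $k$. A plane passing through the origin is a set $\{x\in\mathbb F_q^3:m_1x_1+m_2x_2+m_3x_3=0\}$ with $(m_1,m_2,m_3)\ne(0,0,0)$. Here $1/\infty=0$. $dx$ is the normalized counting measure on $\mathbb F_q^3$: $\|f\|_{L^p(\mathbb F_q^3,dx)}=\left(q^{-3}\sum_{x\in\mathbb F_q^3}|f(x)|^p\right)^{1/p}$ for $1\le p<\infty$, and $\|f\|_{L^\infty}=\max|f|$. The normalized surface measure $d\sigma_q$ on $H_q$ gives each point of $H_q$ mass $1/|H_q|$, so $$f\ast d\sigma_q(x)=\frac1{|H_q|}\sum_{y\in H_q}f(x-y).$$ *)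

(* Defs.v *)
From HB Require Import structures.
From mathcomp Require Import all_boot all_order all_algebra.
From mathcomp Require Import all_classical all_reals all_analysis.
From mathcomp Require Import complex.
(* The notations of mpoly clash with those of analysis: only its canonical
   instances and coercions are imported. *)
From mathcomp Require Import (canonicals, coercions) mpoly.

Set Implicit Arguments.
Unset Strict Implicit.
Unset Printing Implicit Defensive.

Import Order.TTheory GRing.Theory Num.Theory.

Local Open Scope ring_scope.

Section FiniteFieldGeometry.
Variable F : finFieldType.

Definition homogeneous (k : nat) (P : mpoly.mpoly 3 F) : bool :=
  P \is mpoly.ishomog1 k (@mpoly.mdeg 3).

Definition zero_set (P : mpoly.mpoly 3 F) : {set 'rV[F]_3} :=
  [set x : 'rV[F]_3 | mpoly.meval (x 0) P == 0]%SET.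

Definition plane (m : 'rV[F]_3) : {set 'rV[F]_3} :=
  [set x : 'rV[F]_3 | \sum_(i < 3) m 0 i * x 0 i == 0]%SET.

End FiniteFieldGeometry.

Section Averaging.
Variables (R : realType) (F : finFieldType).

(* The value at p = -oo is a dummy: only 1 <= p is ever used. *)
Definition Lpnorm (p : \bar R) (f : 'rV[F]_3 -> R[i]) : R :=
  match p with
  | p'%:E => ((#|F|%:R ^+ 3)^-1 *
               \sum_(x : 'rV[F]_3) (ComplexField.Normc.normc (f x)) `^ p')
             `^ p'^-1
  | _ => \big[Num.max/0]_(x : 'rV[F]_3) ComplexField.Normc.normc (f x)
  end.

Definition average (H : {set 'rV[F]_3}) (f : 'rV[F]_3 -> R[i]) :
    'rV[F]_3 -> R[i] :=
  fun x => (#|H|%:R)^-1 * \sum_(y in H) f (x - y).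

Definition average_bound (H : {set 'rV[F]_3}) (p r : \bar R) : set R :=
  [set C | forall f : 'rV[F]_3 -> R[i],
             Lpnorm r (average H f) <= C * Lpnorm p f]%classic.

(* For 1 <= p, r the set of admissible constants is nonempty, closed and
   bounded below by 0, so that this infimum is the smallest admissible
   constant. *)
Definition average_norm (H : {set 'rV[F]_3}) (p r : \bar R) : \bar R :=
  ereal_inf [set C%:E | C in average_bound H p r]%classic.

End Averaging.

Definition convex_hull (R : numDomainType) (M : lmodType R) (S : set M) :
    set M :=
  smallest (@convex_set R M) S.

(* Main.v *)
Require Import Defs.
From HB Require Import structures.
From mathcomp Require Import all_boot all_order all_algebra.
From mathcomp Require Import all_classical all_reals all_analysis.
From mathcomp Require Import complex.
From mathcomp Require Import (canonicals, coercions) mpoly.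
From mathcomp Require Import ring lra.

Set Implicit Arguments.
Unset Strict Implicit.
Unset Printing Implicit Defensive.

Import Order.TTheory GRing.Theory Num.Theory.

Local Open Scope classical_set_scope.
Local Open Scope ring_scope.

(** Write [x = 1/p], [y = 1/r], and let [A] be the averaging operator over the
    cone [H], the zero set of the form of degree [k].  The convex hull is the
    trapezium [0 <= x], [y <= 1], [x/3 <= y], [3x - 2 <= y].

    Necessity of the last two inequalities comes from two test functions: the
    indicator function of [- H], whose average equals [1] at the origin, and the
    Dirac mass at the origin, whose average is the normalized indicator of [H].
    A uniform bound on the constants turns each of them into an upper bound on
    [q ^ e], and [q] is unbounded in [Q].

    Sufficiency rests on the endpoint L^(4/3) -> L^4.  Let [T] be [A] minus the
    mean over the whole space.  Since [H] has about [q^2] points, [T] maps L^1 to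
    L^oo with norm O(q) (normalized measure).  On L^2 its norm is O(1/q); this
    replaces the Fourier decay of the surface measure and is obtained without
    characters, because [H] is a cone:
    - [cone_inversion] writes the indicator function of [H] as a combination of
      the indicators of the planes through the origin, the coefficient of a plane
      being proportional to the number of points of [H] in it, plus a constant
      and a multiple of the Dirac mass at the origin;
    - on functions of mean zero the plane averages obey a Parseval identity
      ([sum_slice_form]), so the L^2 norm is governed by the largest plane
      section ([cone_convolution_L2]);
    - a plane not contained in [H] meets it in at most [k q^2 / (q - 1)] points
      ([card_plane_section]), since a line through a point off [H] meets [H] in
      at most [k] points.
    A Marcinkiewicz argument ([marcinkiewicz]) halfway between the two bounds
    yields the endpoint, the powers of [q] cancelling exactly.

    All other points of the trapezium follow because [A] is positive and averages
    against a probability: Hoelder's inequality applied pointwise interpolates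
    the endpoint with the trivial L^oo and L^1 bounds ([strong_type]), and the
    normalized norms increase with the exponent. *)

(** * Counting in orthogonal complements over a finite field *)

Section Orthogonality.
Variable F : finFieldType.

(** The standard bilinear form on row vectors. *)
Definition dot n (x y : 'rV[F]_n) : F := \sum_(i < n) x 0 i * y 0 i.

Lemma dotC n (x y : 'rV[F]_n) : dot x y = dot y x.
Proof. by apply: eq_bigr => i _; rewrite mulrC. Qed.

Lemma dot_mulmx n (x y : 'rV[F]_n) : x *m y^T = (dot x y)%:M.
Proof.
apply/matrixP => i j; rewrite !ord1 !mxE /= mulr1n.
by apply: eq_bigr => k _; rewrite mxE.
Qed.

Lemma dotDl n (x y z : 'rV[F]_n) : dot (x + y) z = dot x z + dot y z.
Proof. by rewrite -big_split; apply: eq_bigr => i _; rewrite mxE mulrDl. Qed.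

Lemma dotZl n a (x z : 'rV[F]_n) : dot (a *: x) z = a * dot x z.
Proof. by rewrite mulr_sumr; apply: eq_bigr => i _; rewrite mxE mulrA. Qed.

Lemma dot0l n (z : 'rV[F]_n) : dot 0 z = 0.
Proof. by rewrite -(scale0r 0) dotZl mul0r. Qed.

Lemma dotBl n (x y z : 'rV[F]_n) : dot (x - y) z = dot x z - dot y z.
Proof. by rewrite -scaleN1r dotDl dotZl mulN1r. Qed.

Lemma dot0r n (z : 'rV[F]_n) : dot z 0 = 0.
Proof. by rewrite dotC dot0l. Qed.

Lemma dotDr n (x y z : 'rV[F]_n) : dot z (x + y) = dot z x + dot z y.
Proof. by rewrite dotC dotDl !(dotC z). Qed.

Lemma dotZr n a (x z : 'rV[F]_n) : dot z (a *: x) = a * dot z x.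
Proof. by rewrite dotC dotZl dotC. Qed.

Lemma dotBr n (x y z : 'rV[F]_n) : dot z (x - y) = dot z x - dot z y.
Proof. by rewrite dotC dotBl !(dotC z). Qed.

Lemma mulmx_tr_eq0 n (x y : 'rV[F]_n) : (x *m y^T == 0) = (dot x y == 0).
Proof.
rewrite dot_mulmx; apply/eqP/eqP => [/matrixP/(_ 0 0)|->]; last exact: raddf0.
by rewrite !mxE mulr1n.
Qed.

(** The fibres of a surjective linear map are translates of one another, so
    they all have the same size. *)
Lemma card_mulmx_fiber n m (A : 'M[F]_(n, m)) (w : 'rV[F]_m) :
  row_full A ->
  (#|[pred xi : 'rV[F]_n | xi *m A == w]| * #|F| ^ m = #|F| ^ n)%N.
Proof.
case/row_fullP => B BA.
have fibE u : #|[pred xi : 'rV[F]_n | xi *m A == u]| =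
              #|[pred xi : 'rV[F]_n | xi *m A == w]|.
  rewrite -!sum1_card.
  rewrite (reindex (fun xi => xi + (u - w) *m B)) /=; last first.
    by exists (fun xi => xi - (u - w) *m B) => xi _; rewrite ?addrK ?subrK.
  apply: eq_bigl => xi; rewrite !inE (mulmxDl xi) -mulmxA BA mulmx1 addrCA.
  by rewrite -[X in _ == X]addr0 (inj_eq (addrI _)) subr_eq0.
have <- : (\sum_(xi : 'rV[F]_n) 1)%N = (#|F| ^ n)%N.
  by rewrite sum1_card card_mx mul1n.
rewrite (partition_big (fun xi => xi *m A) xpredT) //=.
rewrite (eq_bigr (fun=> #|[pred xi : 'rV[F]_n | xi *m A == w]|)) => [|u _].
  by rewrite sum_nat_const card_mx mul1n mulnC.
by rewrite -(fibE u) -sum1_card; apply: eq_bigl.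
Qed.

Lemma card_orthogonal1 n (x : 'rV[F]_n.+1) : x != 0 ->
  #|[pred xi : 'rV[F]_n.+1 | dot xi x == 0]| = (#|F| ^ n)%N.
Proof.
move=> x0; have full : row_full x^T.
  by rewrite /row_full mxrank_tr rank_rV x0.
have := card_mulmx_fiber 0 full.
rewrite expn1 expnSr => /eqP; rewrite eqn_pmul2r; last first.
  by apply/card_gt0P; exists 0.
move=> /eqP <-; apply: eq_card => xi; by rewrite !inE mulmx_tr_eq0.
Qed.

Lemma card_orthogonal2 n (x y : 'rV[F]_n.+2) :
  x != 0 -> (forall t, y != t *: x) ->
  #|[pred xi : 'rV[F]_n.+2 | (dot xi x == 0) && (dot xi y == 0)]|
    = (#|F| ^ n)%N.
Proof.
move=> x0 yx.
have free : row_free (col_mx x y).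
  apply: inj_row_free => v; rewrite -[v]hsubmxK mul_row_col.
  rewrite [lsubmx v]mx11_scalar [rsubmx v]mx11_scalar !mul_scalar_mx.
  set a := _ 0 0; set b := _ 0 0 => /eqP; have [->|b0] := eqVneq b 0.
    rewrite scale0r addr0 scaler_eq0 (negPf x0) orbF => /eqP ->.
    by rewrite !raddf0 row_mx0.
  move/eqP/(canRL (addKr _)); rewrite addr0 => /(canRL (scalerK b0)) yE.
  by have := yx (b^-1 * - a); rewrite {1}yE -scaleNr scalerA eqxx.
have full : row_full (row_mx x^T y^T) by rewrite -tr_col_mx /row_full mxrank_tr.
have : (_ * #|F| ^ 2 = #|F| ^ n.+2)%N := card_mulmx_fiber 0 full.
have -> : (#|F| ^ n.+2 = #|F| ^ n * #|F| ^ 2)%N by rewrite -expnD addn2.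
move=> /eqP; rewrite eqn_pmul2r; last first.
  by rewrite expn_gt0 orbC /=; apply/card_gt0P; exists 0.
move=> /eqP <-; apply: eq_card => xi; rewrite !inE mul_mx_row.
by rewrite row_mx_eq0 !mulmx_tr_eq0.
Qed.

End Orthogonality.

(** * Cones as combinations of planes *)

Section Cone.
Variables (F : finFieldType) (R : realFieldType) (H : {set 'rV[F]_3}).
Hypothesis H0 : 0 \in H.
Hypothesis HZ : forall t x, x \in H -> t *: x \in H.

Local Notation q := (#|F|%:R : R).

(** The number of points of [H] in the plane orthogonal to [xi], as a real
    number; for [xi = 0] it is the size of [H]. *)
Definition section (xi : 'rV[F]_3) : R := \sum_(y in H) (dot xi y == 0)%:R.

Lemma sum_pred1 (T : finType) (P : pred T) :
  \sum_(x : T) (P x)%:R = #|[pred x | P x]|%:R :> R.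
Proof.
rewrite -sum1_card natr_sum [RHS]big_mkcond; apply: eq_bigr => x _.
by rewrite inE; case: (P x).
Qed.

Lemma sum_indicator (T : finType) (A : {set T}) (P : pred T) :
  \sum_(x in A) (P x)%:R = #|[pred x | (x \in A) && P x]|%:R :> R.
Proof.
rewrite -sum1_card natr_sum [LHS]big_mkcond [RHS]big_mkcond.
by apply: eq_bigr => x _; rewrite inE; case: (x \in A); case: (P x).
Qed.

(** A cone meets a line through the origin either in the whole line or in the
    origin only. *)
Lemma card_cone_line x : x != 0 ->
  \sum_(y in H) [exists t, y == t *: x]%:R = 1 + (q - 1) * (x \in H)%:R :> R.
Proof.
move=> x0; rewrite sum_indicator; have [xH|xH] := boolP (x \in H).
  rewrite mulr1 subrKC.
  have <- : #|codom (fun t : F => t *: x)| = #|F|.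
    by apply: card_codom => s t /eqP; rewrite -subr_eq0 -scalerBl scaler_eq0
      (negPf x0) orbF subr_eq0 => /eqP.
  congr _%:R; apply: eq_card => y; rewrite !inE; apply/andP/codomP.
    by move=> [_ /existsP[t /eqP ->]]; exists t.
  by move=> [t ->]; split; [exact: HZ | apply/existsP; exists t].
rewrite mulr0 addr0.
transitivity (#|pred1 (0 : 'rV[F]_3)|%:R : R); last by rewrite card1.
congr _%:R.
apply: eq_card => y; rewrite !inE; apply/andP/eqP => [[yH /existsP[t /eqP yE]]|->].
  have [t0|t0] := eqVneq t 0; first by rewrite yE t0 scale0r.
  by move: xH; rewrite -[x](scalerK t0) -yE HZ.
by split=> //; apply/existsP; exists 0; rewrite scale0r.
Qed.

Lemma card_orthogonal_pair (x y : 'rV[F]_3) : x != 0 ->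
  \sum_(xi : 'rV[F]_3) ((dot xi x == 0) && (dot xi y == 0))%:R =
    q + (q ^+ 2 - q) * [exists t, y == t *: x]%:R :> R.
Proof.
move=> x0; rewrite sum_pred1; case: existsP => [[t /eqP ->]|nyx].
  rewrite mulr1 addrC subrK -natrX -(card_orthogonal1 x0).
  congr _%:R; apply: eq_card => xi; rewrite !inE dotZr.
  by case: eqP => // ->; rewrite mulr0 eqxx.
rewrite mulr0 addr0 (@card_orthogonal2 _ 1) ?expn1// => t.
by apply: contra_notN nyx => yE; exists t.
Qed.

Lemma sum_dot_eq0 (x : 'rV[F]_3) :
  \sum_(xi : 'rV[F]_3) (dot xi x == 0)%:R = q ^+ 2 + (q ^+ 3 - q ^+ 2) * (x == 0)%:R :> R.
Proof.
rewrite sum_pred1; case: (eqVneq x 0) => [->|x0].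
  rewrite mulr1 addrC subrK -natrX; congr _%:R.
  rewrite -[RHS](card_mx F 1 3); apply: eq_card => xi.
  by rewrite !inE dot0r eqxx.
by rewrite mulr0 addr0 -natrX -(card_orthogonal1 x0).
Qed.

(** A cone is, up to a constant and a multiple of the Dirac mass at the origin,
    a linear combination of planes through the origin, weighted in proportion to
    the number of points of the cone in them.  This is Fourier inversion for a
    function invariant under dilations: grouping the frequencies by lines turns
    characters into indicators of planes. *)
Lemma cone_inversion x :
  q * (q - 1) ^+ 2 * (x \in H)%:R =
  \sum_(xi : 'rV[F]_3) section xi * (dot xi x == 0)%:R
  - (q * #|H|%:R + q ^+ 2 - q) - #|H|%:R * q * (q - 1) * (x == 0)%:R.
Proof.
have -> : \sum_(xi : 'rV[F]_3) section xi * (dot xi x == 0)%:R =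
    \sum_(y in H) \sum_(xi : 'rV[F]_3) ((dot xi x == 0) && (dot xi y == 0))%:R :> R.
  rewrite exchange_big; apply: eq_bigr => xi _; rewrite mulr_suml.
  by apply: eq_bigr => y _; rewrite -mulnb natrM mulrC.
case: (eqVneq x 0) => [->|x0].
  have -> : \sum_(y in H) \sum_(xi : 'rV[F]_3) ((dot xi 0 == 0) && (dot xi y == 0))%:R =
     q ^+ 2 * #|H|%:R + (q ^+ 3 - q ^+ 2) :> R.
    under eq_bigr => y _.
      under eq_bigr => xi _ do rewrite dot0r eqxx.
      rewrite sum_dot_eq0; over.
    rewrite big_split /= sumr_const -mulr_sumr [q ^+ 2 * _]mulr_natr; congr (_ + _).
    rewrite (bigD1 0) //= eqxx big1 ?addr0 ?mulr1// => y /andP[_ /negPf ->] //.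
  rewrite H0 /=; ring.
under eq_bigr => y _ do rewrite card_orthogonal_pair //.
rewrite big_split /= sumr_const -mulr_sumr card_cone_line // -[q *+ _]mulr_natr /=.
ring.
Qed.

End Cone.

(** * The L^2 estimate for convolution with a cone *)

Section Slices.
Variables (F : finFieldType) (R : realFieldType).
Implicit Types (f g : 'rV[F]_3 -> R) (xi : 'rV[F]_3).

Local Notation q := (#|F|%:R : R).

(** Summing [f] over the translates of the plane orthogonal to [xi] gives a
    function on [F]; this is the scalar product of the functions so obtained
    from [f] and [g]. *)
Definition slice_form xi f g : R :=
  \sum_(t : F) (\sum_(x | dot xi x == t) f x) * (\sum_(y | dot xi y == t) g y).

Lemma slice_formE xi f g :
  slice_form xi f g = \sum_x \sum_y f x * g y * (dot xi (x - y) == 0)%:R.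
Proof.
rewrite /slice_form [RHS](partition_big (dot xi) predT) //=.
apply: eq_bigr => t _; rewrite mulr_suml; apply: eq_bigr => x /eqP xt.
rewrite big_mkcond mulr_sumr; apply: eq_bigr => y _.
rewrite dotBr xt subr_eq0 eq_sym.
by case: eqP => _; rewrite ?mulr1 ?mulr0.
Qed.

Lemma slice_form0 f g : slice_form 0 f g = (\sum_x f x) * (\sum_x g x).
Proof.
rewrite slice_formE mulr_suml; apply: eq_bigr => x _; rewrite mulr_sumr.
by apply: eq_bigr => y _; rewrite dot0l eqxx mulr1.
Qed.

Lemma slice_form_ge0 xi f : 0 <= slice_form xi f f.
Proof. by apply: sumr_ge0 => t _; rewrite -expr2 sqr_ge0. Qed.

Lemma young2 (lam u v : R) : 0 < lam ->
  u * v <= (lam * u ^+ 2 + lam^-1 * v ^+ 2) / 2.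
Proof.
move=> l0; rewrite ler_pdivlMr // -subr_ge0.
have -> : lam * u ^+ 2 + lam^-1 * v ^+ 2 - u * v * 2
          = lam^-1 * (lam * u - v) ^+ 2 by field; rewrite gt_eqF.
by rewrite mulr_ge0 ?invr_ge0 ?sqr_ge0 ?ltW.
Qed.

Lemma slice_form_young (lam : R) xi f g : 0 < lam ->
  slice_form xi f g <=
    (lam * slice_form xi f f + lam^-1 * slice_form xi g g) / 2.
Proof.
move=> l0; rewrite /slice_form !mulr_sumr -big_split mulr_suml /=.
by apply: ler_sum => t _; rewrite -!expr2; exact: young2.
Qed.

(** Parseval for the slices of a function of mean zero. *)
Lemma sum_slice_form f : \sum_x f x = 0 ->
  \sum_xi slice_form xi f f = (q ^+ 3 - q ^+ 2) * \sum_x f x ^+ 2.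
Proof.
move=> f0; under eq_bigr => xi _ do rewrite slice_formE.
rewrite exchange_big mulr_sumr /=; apply: eq_bigr => x _.
rewrite exchange_big /=.
under eq_bigr => y _ do rewrite -mulr_sumr sum_dot_eq0 subr_eq0 mulrDr.
rewrite big_split /= -mulr_suml -mulr_sumr f0 mulr0 mul0r add0r.
rewrite (bigD1 x) //= eqxx mulr1 big1 ?addr0 => [|y /negPf yx].
  by rewrite mulrC expr2.
by rewrite eq_sym yx !mulr0.
Qed.

Variable H : {set 'rV[F]_3}.
Hypothesis H0 : 0 \in H.
Hypothesis HZ : forall t x, x \in H -> t *: x \in H.
Variable M : R.
Hypothesis HM : forall xi, xi != 0 -> section R H xi <= M.

Let q_gt1 : 1 < q.
Proof. by rewrite ltr1n; exact: card_finNzRing_gt1. Qed.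

Let section_bound_ge0 : 0 <= M.
Proof.
have xi0 : const_mx 1 != 0 :> 'rV[F]_3.
  by apply/eqP => /matrixP/(_ 0 0)/eqP; rewrite !mxE oner_eq0.
by apply: le_trans (HM xi0); apply: sumr_ge0 => y _; exact: ler0n.
Qed.

(** The free parameter [lam] is optimized in [cone_convolution_L2]. *)
Lemma cone_form_le (lam : R) f g : 0 < lam ->
  \sum_x f x = 0 -> \sum_x g x = 0 ->
  2 * (q - 1) * \sum_x \sum_y f x * g y * (x - y \in H)%:R <=
  (q * M + #|H|%:R) * (lam * \sum_x f x ^+ 2 + lam^-1 * \sum_x g x ^+ 2).
Proof.
move=> l0 f0 g0.
have M0 := section_bound_ge0.
set S := lam * _ + _.
have S_E : q * (q - 1) ^+ 2 * \sum_x \sum_y f x * g y * (x - y \in H)%:R =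
    \sum_xi section R H xi * slice_form xi f g
    - #|H|%:R * q * (q - 1) * \sum_x f x * g x.
  rewrite [LHS]mulr_sumr.
  rewrite (eq_bigr (fun x => \sum_xi section R H xi *
      (\sum_y f x * g y * (dot xi (x - y) == 0)%:R)
      - #|H|%:R * q * (q - 1) * (f x * g x))) => [|x _].
    rewrite sumrB -mulr_sumr exchange_big; congr (_ - _).
    by apply: eq_bigr => xi _; rewrite slice_formE mulr_sumr.
  rewrite mulr_sumr (eq_bigr (fun y =>
      \sum_xi section R H xi * (f x * g y * (dot xi (x - y) == 0)%:R)
      - f x * (q * #|H|%:R + q ^+ 2 - q) * g y
      - #|H|%:R * q * (q - 1) * f x * (g y * (x == y)%:R))) => [|y _].
    rewrite !sumrB -!mulr_sumr g0 mulr0 subr0 exchange_big; congr (_ - _).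
      by apply: eq_bigr => xi _; rewrite mulr_sumr.
    rewrite (bigD1 x) //= eqxx mulr1 big1 ?addr0 ?mulrA // => y /negPf yx.
    by rewrite eq_sym yx mulr0.
  rewrite mulrCA (cone_inversion R H0 HZ) !mulrBr subr_eq0 mulr_sumr.
  congr (_ - _ - _); last by ring.
    by apply: eq_bigr => xi _; rewrite mulrCA.
  by ring.
have le1 : \sum_xi section R H xi * slice_form xi f g
    <= M * (q ^+ 3 - q ^+ 2) * S / 2.
  have -> : M * (q ^+ 3 - q ^+ 2) * S / 2 =
     \sum_xi M * ((lam * slice_form xi f f + lam^-1 * slice_form xi g g) / 2).
    rewrite -mulr_sumr -mulr_suml big_split /= -!mulr_sumr !sum_slice_form //.
    by rewrite /S; ring.
  apply: ler_sum => xi _.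
  have yg : 0 <= (lam * slice_form xi f f + lam^-1 * slice_form xi g g) / 2.
    by rewrite divr_ge0 // addr_ge0 // mulr_ge0 ?slice_form_ge0 ?invr_ge0 ?ltW.
  case: (eqVneq xi 0) yg => [->|xi0] yg.
    by rewrite (slice_form0 f g) f0 mul0r mulr0 mulr_ge0.
  apply: le_trans (ler_wpM2l _ (slice_form_young xi f g l0)) _.
    by apply: sumr_ge0 => y _; exact: ler0n.
  by apply: ler_wpM2r => //; exact: HM.
have le2 : - \sum_x f x * g x <= S / 2.
  rewrite -sumrN /S !mulr_sumr -big_split mulr_suml /=.
  apply: ler_sum => x _; rewrite -mulNr -[f x ^+ 2]sqrrN; exact: young2.
have qq : 0 < q * (q - 1) by rewrite mulr_gt0 ?subr_gt0 // (lt_trans ltr01).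
(* [cone_inversion] produces the extra factor [q * (q - 1)]. *)
rewrite -(ler_pM2l qq).
have -> : q * (q - 1) * (2 * (q - 1) * \sum_x \sum_y f x * g y * (x - y \in H)%:R)
  = 2 * (q * (q - 1) ^+ 2 * \sum_x \sum_y f x * g y * (x - y \in H)%:R).
  by ring.
rewrite S_E.
have le3 : #|H|%:R * q * (q - 1) * - \sum_x f x * g x <=
           #|H|%:R * q * (q - 1) * (S / 2).
  by rewrite ler_wpM2l // -mulrA mulr_ge0 ?ler0n ?ltW.
move: le1 le3; lra.
Qed.

(** Convolution with the indicator function of [H] on functions of mean zero. *)
Lemma cone_convolution_L2 f : \sum_x f x = 0 ->
  (q - 1) ^+ 2 * \sum_x (\sum_y f y * (x - y \in H)%:R) ^+ 2 <=
  (q * M + #|H|%:R) ^+ 2 * \sum_x f x ^+ 2.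
Proof.
move=> f0; set g := fun x => \sum_y f y * (x - y \in H)%:R.
have g0 : \sum_x g x = 0.
  rewrite /g exchange_big /= (eq_bigr (fun y => f y * #|H|%:R)) => [|y _].
    by rewrite -mulr_suml f0 mul0r.
  rewrite -mulr_sumr; congr (_ * _).
  rewrite (reindex (fun x => x + y)) /=; last first.
    by exists (fun x => x - y) => x _; rewrite ?addrK ?subrK.
  under eq_bigr => x _ do rewrite addrK.
  by rewrite sum_pred1; congr _%:R; exact: eq_card.
have q1 : 0 < q - 1 by rewrite subr_gt0.
set N := q * M + _.
have N0 : 0 < N.
  apply: ltr_wpDl; first by rewrite mulr_ge0 ?ler0n ?section_bound_ge0.
  by rewrite ltr0n; apply/card_gt0P; exists 0.
(* This weight makes the term in [g] half of the left-hand side. *)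
have l0 : 0 < (q - 1) / N by rewrite divr_gt0.
have := cone_form_le l0 g0 f0.
have -> : \sum_x \sum_y g x * f y * (x - y \in H)%:R = \sum_x g x ^+ 2.
  apply: eq_bigr => x _; rewrite expr2 {2}/g mulr_sumr.
  by apply: eq_bigr => y _; rewrite mulrA.
rewrite -/N invf_div.
set A := \sum_x _; set B := \sum_x _.
have -> : N * ((q - 1) / N * A + N / (q - 1) * B) =
          (q - 1) * A + N * N / (q - 1) * B.
  by field; rewrite !gt_eqF.
set C := N * N / (q - 1) * B => h.
have {}h : (q - 1) * A <= C by move: h; lra.
rewrite expr2 -mulrA -ler_pdivlMl //.
by apply: le_trans h _; rewrite (_ : C = (q - 1)^-1 * (N ^+ 2 * B)) // /C; ring.
Qed.

End Slices.

(** * Plane sections of the zero set of a form *)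

Section Polynomial.
Variables (F : finFieldType) (k : nat) (P : mpoly.mpoly 3 F).
Hypothesis hP : homogeneous k P.

Lemma homogeneous_mdeg m : m \in mpoly.msupp P -> mpoly.mdeg m = k.
Proof. by move/mpoly.dhomogP: hP; apply. Qed.

Lemma mevalZ_homogeneous t (x : 'rV[F]_3) :
  mpoly.meval ((t *: x) 0) P = t ^+ k * mpoly.meval (x 0) P.
Proof.
rewrite !mpoly.mevalE mulr_sumr; apply: eq_big_seq => m mP.
rewrite mulrCA; congr (_ * _).
under eq_bigr => i _ do rewrite mxE exprMn.
by rewrite big_split /= prodrXr -mpoly.mdegE homogeneous_mdeg.
Qed.

Lemma zero_set_cone t (x : 'rV[F]_3) : x \in zero_set P -> t *: x \in zero_set P.
Proof. by rewrite !inE mevalZ_homogeneous => /eqP ->; rewrite mulr0. Qed.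

Lemma zero_set_origin : (0 < k)%N -> 0 \in zero_set P.
Proof.
move=> k0; rewrite inE -(scale0r (0 : 'rV[F]_3)) mevalZ_homogeneous.
by rewrite expr0n eqn0Ngt k0 mul0r.
Qed.

Lemma size_mul_le (p r : {poly F}) a b :
  (size p <= a.+1 -> size r <= b.+1 -> size (p * r)%R <= (a + b).+1)%N.
Proof.
move=> pa rb; apply: leq_trans (size_polyMleq _ _) _; rewrite -subn1 leq_subLR.
by apply: leq_trans (leq_add pa rb) _; rewrite addSn addnS.
Qed.

Lemma size_prod_exp_le n (p : 'I_n -> {poly F}) (d : 'I_n -> nat) :
  (forall i, size (p i) <= 2)%N ->
  (size (\prod_i p i ^+ d i)%R <= (\sum_i d i).+1)%N.
Proof.
move=> hp; elim/big_rec2: _ => [|i m r _ IH]; first by rewrite size_poly1.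
apply: size_mul_le IH; elim: (d i) => [|e IHe]; first by rewrite expr0 size_poly1.
by rewrite exprS; apply: (@size_mul_le _ _ 1 e).
Qed.

(** The restriction of [P] to the affine line through [v] directed by [w]. *)
Definition line_poly (v w : 'rV[F]_3) : {poly F} :=
  \sum_(m <- mpoly.msupp P)
    mpoly.mcoeff m P *: \prod_i ((v 0 i)%:P + (w 0 i) *: 'X) ^+ m i.

Lemma horner_line_poly v w u :
  (line_poly v w).[u] = mpoly.meval ((v + u *: w) 0) P.
Proof.
rewrite mpoly.mevalE horner_sum; apply: eq_bigr => m _.
rewrite hornerZ horner_prod; congr (_ * _); apply: eq_bigr => i _.
by rewrite !hornerE /= !mxE mulrC.
Qed.

Lemma size_line_poly v w : (size (line_poly v w) <= k.+1)%N.
Proof.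
rewrite /line_poly big_seq; elim/big_ind: _ => [|p r hp hr|m mP].
- by rewrite size_poly0.
- by apply: leq_trans (size_polyD _ _) _; rewrite geq_max hp.
- apply: leq_trans (size_scale_leq _ _) _.
  rewrite -(homogeneous_mdeg mP) mpoly.mdegE; apply: size_prod_exp_le => i.
  apply: leq_trans (size_polyD _ _) _; rewrite geq_max.
  rewrite (leq_trans (size_polyC_leq1 _)) //.
  by apply: leq_trans (size_scale_leq _ _) _; rewrite size_polyX.
Qed.

Lemma card_line_zeros (v w : 'rV[F]_3) : v \notin zero_set P ->
  (#|[pred u : F | (v + u *: w)%R \in zero_set P]| <= k)%N.
Proof.
move=> vP; have L0 : line_poly v w != 0.
  apply: contraNneq vP => L0.
  by rewrite inE -[v]addr0 -(scale0r w) -horner_line_poly L0 horner0.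
rewrite cardE -ltnS; apply: leq_trans (size_line_poly v w).
apply: max_poly_roots => //; last exact: enum_uniq.
by apply/allP => u; rewrite mem_enum !inE /root horner_line_poly.
Qed.

(** Averaging [card_line_zeros] over all directions [w] of the plane: for a
    fixed parameter [u != 0] the points [v + u *: w] run once through the
    plane. *)
Lemma card_plane_section xi : xi != 0 -> ~~ (plane xi \subset zero_set P) ->
  ((#|F| - 1) * #|[pred x in zero_set P | dot xi x == 0%R]| <= k * #|F| ^ 2)%N.
Proof.
move=> xi0 /subsetPn[v]; rewrite inE -/(dot xi v) => /eqP v0 vP.
have -> : (k * #|F| ^ 2 = \sum_(w | dot xi w == 0%R) k)%N.
  rewrite sum_nat_const -(card_orthogonal1 xi0) mulnC; congr (_ * _)%N.
  by apply: eq_card => w; rewrite inE unfold_in dotC.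
apply: leq_trans (_ : \sum_(w | dot xi w == 0%R)
    \sum_(u : F | u != 0%R) ((v + u *: w)%R \in zero_set P) <= _)%N; last first.
  apply: leq_sum => w _; apply: leq_trans (card_line_zeros w vP).
  rewrite -sum1_card big_mkcond [leqRHS]big_mkcond /=.
  apply: leq_sum => u _; rewrite [in leqRHS]inE /=.
  by case: (u != 0); case: (_ \in zero_set P).
rewrite exchange_big /= (eq_bigr (fun=>
   #|[pred x in zero_set P | dot xi x == 0%R]|)) => [|u u0]; last first.
  rewrite -sum1_card.
  rewrite [RHS](reindex (fun w => v + u *: w)) /=; last first.
    exists (fun x => u^-1 *: (x - v)) => x _.
      by rewrite addrC addKr scalerK.
    by rewrite scalerKV // subrKC.
  rewrite big_mkcond [RHS]big_mkcond; apply: eq_bigr => w _.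
  rewrite [in RHS]inE /= dotDr dotZr v0 add0r mulf_eq0 (negPf u0) /=.
  by case: (dot xi w == 0); rewrite ?andbF ?andbT //; case: (_ \in zero_set P).
rewrite sum_nat_const leq_mul // subn1 -(cardC1 (0 : F)).
by apply: eq_leq; apply: eq_card.
Qed.

End Polynomial.

(** * Marcinkiewicz interpolation between (1, oo) and (2, 2) *)

Section WeakType.
Variable R : realFieldType.

(** Layer-cake decomposition of the square: each [x] of the list satisfies
    [x ^+ 2 = \sum_(v <= x) w], the sum running over the pairs [(v, w)] of [J],
    while the right-hand side is at most [t ^+ 2] at an arbitrary level [t]. *)
Lemma layer_cake (s : seq R) : all (fun a => 0 <= a) s ->
  exists J : seq (R * R), [/\
    all (fun vw => (0 < vw.1) && (0 <= vw.2)) J,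
    forall a, a \in s -> \sum_(vw <- J | vw.1 <= a) vw.2 = a ^+ 2 &
    forall t, 0 <= t -> \sum_(vw <- J | vw.1 <= t) vw.2 <= t ^+ 2].
Proof.
wlog sorted_s : s / sorted >=%R s => [hwlog|] hs.
  have [|J [J0 J1 J2]] := hwlog (sort >=%R s) (sort_sorted (@ge_total _ R) s).
    by rewrite all_sort.
  by exists J; split=> // a; rewrite -(mem_sort >=%R); exact: J1.
pose good (s : seq R) (J : seq (R * R)) := [/\
    all (fun vw => [&& (0 < vw.1), (0 <= vw.2) & (vw.1 \in s)]) J,
    forall a, a \in s -> \sum_(vw <- J | vw.1 <= a) vw.2 = a ^+ 2 &
    forall t, 0 <= t -> \sum_(vw <- J | vw.1 <= t) vw.2 <= t ^+ 2].
suff [J [J0 J1 J2]] : exists J, good s J.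
  by exists J; split=> //; apply: sub_all J0 => vw /and3P[-> ->].
(* The list is decreasing: each new maximum [m] receives the weight missing to
   reach [m ^+ 2]. *)
elim: s sorted_s hs => [|m s IH] /=.
  by exists [::]; split=> // t _; rewrite big_nil sqr_ge0.
rewrite (path_sortedE (rev_trans (@le_trans _ R))) => /andP[ms sorted_s].
move=> /andP[m0 hs]; have [J [J0 J1 J2]] := IH sorted_s hs.
have Jm t : m <= t -> \sum_(vw <- J | vw.1 <= t) vw.2 = \sum_(vw <- J) vw.2.
  move=> mt; rewrite big_seq_cond [RHS]big_seq; apply: eq_bigl => vw.
  case vwJ: (vw \in J) => //=; apply: le_trans mt.
  by have /and3P[_ _ /(allP ms)] := allP J0 _ vwJ.
move: m0; rewrite le_eqVlt => /predU1P[m0|m0].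
  exists J; split=> [|a|]; last exact: J2.
    by apply: sub_all J0 => vw /and3P[-> -> vs] /=; rewrite inE vs orbT.
  rewrite inE => /predU1P[->|]; last exact: J1.
  rewrite -m0 big_seq_cond big1 ?expr0n //= => vw /andP[/(allP J0)/and3P[v0 _ _]].
  by rewrite leNgt v0.
exists ((m, m ^+ 2 - \sum_(vw <- J) vw.2) :: J); split=> [|a|t t0].
- apply/andP; split.
    rewrite /= m0 mem_head andbT subr_ge0 -(Jm m) //; exact/J2/ltW.
  by apply: sub_all J0 => vw /and3P[-> -> vs] /=; rewrite inE vs orbT.
- rewrite big_cons /=; case: (leP m a) => [ma|am].
    rewrite Jm // subrK => /predU1P[->//|/(allP ms) am].
    by congr (_ ^+ 2); apply/eqP; rewrite eq_le ma.
  by rewrite inE lt_eqF //=; exact: J1.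
- rewrite big_cons /=; case: (leP m t) => [mt|_]; last exact: J2.
  by rewrite Jm // subrK ler_sqr // nnegrE ltW.
Qed.

Lemma cauchy_schwarz (I : finType) (u v : I -> R) :
  (\sum_i u i * v i) ^+ 2 <= (\sum_i u i ^+ 2) * \sum_i v i ^+ 2.
Proof.
set U := \sum_i u i ^+ 2; set V := \sum_i v i ^+ 2; set W := \sum_i u i * v i.
have V0 : 0 <= V by apply: sumr_ge0 => i _; exact: sqr_ge0.
have : 0 <= V * (U * V - W ^+ 2).
  have -> : V * (U * V - W ^+ 2) = \sum_i (V * u i - W * v i) ^+ 2.
    rewrite (eq_bigr (fun i => V ^+ 2 * u i ^+ 2 - 2 * V * W * (u i * v i)
      + W ^+ 2 * v i ^+ 2)) => [|i _]; last by ring.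
    by rewrite !big_split /= sumrN -!mulr_sumr -/U -/V -/W; ring.
  by apply: sumr_ge0 => i _; exact: sqr_ge0.
move: V0; rewrite le_eqVlt => /predU1P[V0 _|V0]; last first.
  by rewrite pmulr_rge0 // subr_ge0.
rewrite -V0 mulr0 /W big1 ?expr0n //= => i _.
have /eqP := esym V0; rewrite psumr_eq0 => [|j _]; last exact: sqr_ge0.
by move=> /allP/(_ i (mem_index_enum _)); rewrite sqrf_eq0 => /eqP ->; rewrite mulr0.
Qed.

(** Marcinkiewicz interpolation between L^1 -> L^oo (norm at most [kappa]) and
    L^2 -> L^2 (norm at most the square root of [B]), at the midpoint
    L^(4/3) -> L^4.  Writing the function as a cube turns all fractional
    powers into integral ones. *)
Lemma marcinkiewicz (X : finType) (K : X -> X -> R) (kappa B : R) :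
  0 < kappa -> 0 <= B ->
  (forall x y, `|K x y| <= kappa) ->
  (forall f : X -> R,
     \sum_x (\sum_y K x y * f y) ^+ 2 <= B * \sum_x f x ^+ 2) ->
  forall h : X -> R, (forall x, 0 <= h x) ->
  \sum_x (\sum_y K x y * h y ^+ 3) ^+ 4 <=
    16 * B * kappa ^+ 2 * (\sum_x h x ^+ 4) ^+ 3.
Proof.
move=> k0 B0 hK hB h h0; set S := \sum_x h x ^+ 4.
pose T (f : X -> R) x := \sum_y K x y * f y.
rewrite -/(T (fun y => h y ^+ 3)); set G := T (fun y => h y ^+ 3).
have S0 : 0 <= S by apply: sumr_ge0 => x _; rewrite exprn_ge0.
move: (S0); rewrite le_eqVlt => /predU1P[S0'|Sgt0].
  have hx0 y : h y = 0.
    have /eqP := esym S0'; rewrite psumr_eq0 => [|j _]; last by rewrite exprn_ge0.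
    by move=> /allP/(_ y (mem_index_enum _)); rewrite expf_eq0 => /andP[_ /eqP].
  rewrite -S0' expr0n mulr0 big1 // => x _.
  by rewrite /G /T big1 ?expr0n // => y _; rewrite hx0 expr0n mulr0.
have [|J [J0 J1 J2]] := @layer_cake [seq `|G x| | x <- enum X].
  by apply/allP => _ /mapP[x _ ->].
(* The part of [h] below the threshold attached to the level [v]; the rest
   contributes at most [v / 2] to [G], uniformly. *)
pose small v y := h y * v <= 2 * kappa * S.
have G_small v x : 0 < v -> v <= `|G x| ->
    G x ^+ 2 <= 4 * T (fun y => h y ^+ 3 * (small v y)%:R) x ^+ 2.
  move=> v0 vG; set E := T _ x.
  have big_le : `|G x - E| <= v / 2.
    have -> : G x - E = \sum_y K x y * (h y ^+ 3 * (~~ small v y)%:R).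
      rewrite /G /E /T -sumrB; apply: eq_bigr => y _.
      by case: (small v y); rewrite /= ?mulr1 ?mulr0 ?subrr ?subr0.
    have -> : v / 2 = \sum_y v * h y ^+ 4 / (2 * S).
      by rewrite -mulr_suml -mulr_sumr -/S; field; rewrite gt_eqF.
    apply: le_trans (ler_norm_sum _ _ _) _; apply: ler_sum => y _.
    have [ysm|ybig] := boolP (small v y).
      rewrite !mulr0 normr0 divr_ge0 // ?mulr_ge0 ?exprn_ge0 // ltW //.
    move: ybig; rewrite -ltNge mulr1 => ybig.
    rewrite normrM (ger0_norm (exprn_ge0 _ _)) //.
    apply: le_trans (_ : kappa * h y ^+ 3 <= _).
      by rewrite ler_wpM2r ?exprn_ge0.
    rewrite ler_pdivlMr ?mulr_gt0 //.
    have -> : kappa * h y ^+ 3 * (2 * S) = 2 * kappa * S * h y ^+ 3 by ring.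
    have -> : v * h y ^+ 4 = h y * v * h y ^+ 3 by ring.
    by rewrite ler_wpM2r ?exprn_ge0 // ltW.
  have le2 : `|G x| <= 2 * `|E|.
    have := ler_normD (G x - E) E; rewrite subrK; lra.
  rewrite -(real_normK (num_real (G x))) -(real_normK (num_real E)).
  have -> : 4 * `|E| ^+ 2 = (2 * `|E|) ^+ 2 by ring.
  by rewrite ler_sqr ?nnegrE ?mulr_ge0.
have -> : \sum_x G x ^+ 4 =
    \sum_(vw <- J) vw.2 * \sum_(x | vw.1 <= `|G x|) G x ^+ 2.
  transitivity (\sum_x \sum_(vw <- J | vw.1 <= `|G x|) vw.2 * G x ^+ 2).
    apply: eq_bigr => x _; rewrite -mulr_suml J1; last first.
      by apply/mapP; exists x; rewrite ?mem_enum.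
    by rewrite real_normK ?num_real // -exprD.
  rewrite (exchange_big_dep xpredT) //=; apply: eq_bigr => vw _.
  by rewrite mulr_sumr.
have -> : 16 * B * kappa ^+ 2 * S ^+ 3 =
    4 * B * \sum_y (2 * kappa * S) ^+ 2 * h y ^+ 4.
  by rewrite -mulr_sumr -/S; ring.
apply: le_trans (_ : 4 * B * \sum_(vw <- J) vw.2 *
    \sum_y h y ^+ 6 * (small vw.1 y)%:R <= _).
  rewrite mulr_sumr !big_seq; apply: ler_sum => vw vwJ.
  have /andP[v0 w0] := allP J0 _ vwJ; rewrite mulrCA ler_wpM2l //.
  apply: le_trans (_ : \sum_x 4 * T (fun y => h y ^+ 3 * (small vw.1 y)%:R) x ^+ 2 <= _).
    rewrite big_mkcond; apply: ler_sum => x _; case: ifP => [|_]; first exact: G_small.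
    by rewrite mulr_ge0 ?sqr_ge0.
  rewrite -mulr_sumr -mulrA ler_wpM2l //; apply: le_trans (hB _) _.
  rewrite ler_wpM2l //; apply: ler_sum => y _.
  by rewrite exprMn -exprM; case: (small _ _); rewrite ?expr1n ?expr0n.
rewrite ler_wpM2l ?mulr_ge0 //.
under eq_bigr => vw _ do rewrite mulr_sumr.
rewrite exchange_big; apply: ler_sum => y _ /=.
have [hy0|hy0] := eqVneq (h y) 0.
  by rewrite big1 => [|vw _]; rewrite hy0 !expr0n /= ?(mul0r, mulr0).
have hy : 0 < h y by rewrite lt_def hy0 h0.
rewrite (eq_bigr (fun vw : R * R => h y ^+ 6 * (vw.2 * (small vw.1 y)%:R)))
  => [|vw _]; last by ring.
rewrite -mulr_sumr.
rewrite (_ : \sum_(vw <- J) _ = \sum_(vw <- J | vw.1 <= 2 * kappa * S / h y) vw.2).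
  apply: le_trans (_ : h y ^+ 6 * (2 * kappa * S / h y) ^+ 2 <= _).
    rewrite ler_wpM2l ?exprn_ge0 //; apply: J2.
    by rewrite divr_ge0 ?mulr_ge0 // ltW.
  by rewrite le_eqVlt; apply/orP; left; apply/eqP; field.
rewrite [RHS]big_mkcond; apply: eq_bigr => vw _.
by rewrite ler_pdivlMr // mulrC /small [_ * h y]mulrC; case: ifP; rewrite ?mul1r ?mul0r.
Qed.

End WeakType.

(** * The endpoint estimate *)

Section Endpoint.
Variables (F : finFieldType) (R : realFieldType) (H : {set 'rV[F]_3}).
Implicit Types (f g h : 'rV[F]_3 -> R).

Local Notation q := (#|F|%:R : R).
Local Notation N := (#|H|%:R : R).

(** The average over [H] for real-valued functions. *)
Definition real_average f : 'rV[F]_3 -> R :=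
  fun x => N^-1 * \sum_(y in H) f (x - y).

Lemma real_averageE f x :
  real_average f x = N^-1 * \sum_y f y * (x - y \in H)%:R.
Proof.
rewrite /real_average big_mkcond; congr (_ * _).
rewrite (reindex (fun y => x - y)) /=; last first.
  by exists (fun y => x - y) => y _; rewrite subKr.
by apply: eq_bigr => y _; rewrite subKr; case: ifP; rewrite ?mulr1 ?mulr0.
Qed.

Lemma sum_translate_indicator (x : 'rV[F]_3) : \sum_y (x - y \in H)%:R = N.
Proof.
rewrite (reindex (fun y => x - y)) /=; last first.
  by exists (fun y => x - y) => y _; rewrite subKr.
under eq_bigr => y _ do rewrite subKr.
by rewrite sum_pred1; congr _%:R; exact: eq_card.
Qed.

Lemma sum_const_space (c : R) : \sum_(x : 'rV[F]_3) c = q ^+ 3 * c.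
Proof. by rewrite sumr_const card_mx -[LHS]mulr_natl natrX. Qed.

Variables (k : nat) (c1 c2 : R).
Hypotheses (c1_gt0 : 0 < c1) (HN : c1 * q ^+ 2 <= N <= c2 * q ^+ 2).
Hypothesis H0 : 0 \in H.
Hypothesis HZ : forall t x, x \in H -> t *: x \in H.
Hypothesis Hsec :
  forall xi, xi != 0 -> (q - 1) * section R H xi <= k%:R * q ^+ 2.

Let q_ge2 : 2 <= q.
Proof. by rewrite ler_nat; exact: card_finNzRing_gt1. Qed.
Let q_gt0 : 0 < q. Proof. by apply: lt_le_trans q_ge2. Qed.
Let N_gt0 : 0 < N.
Proof. by case/andP: HN => + _; apply: lt_le_trans; rewrite mulr_gt0 ?exprn_gt0. Qed.
Let c2_gt0 : 0 < c2.
Proof.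
case/andP: HN => _ /(lt_le_trans N_gt0).
by rewrite pmulr_lgt0 // exprn_gt0.
Qed.

(* [D / q] bounds the L^2 norm of the average on functions of mean zero. *)
Let D := 2 * (2 * k%:R + c2) / c1.

Lemma mean_zero_L2 f : \sum_x f x = 0 ->
  \sum_x (real_average f x) ^+ 2 <= D ^+ 2 / q ^+ 2 * \sum_x f x ^+ 2.
Proof.
move=> f0; have q1 : 0 < q - 1 by move: q_ge2; lra.
have sec_le xi : xi != 0 -> section R H xi <= 2 * k%:R * q.
  move=> /Hsec; rewrite -ler_pdivlMl // => /le_trans; apply.
  rewrite ler_pdivrMl // -subr_ge0.
  have -> : (q - 1) * (2 * k%:R * q) - k%:R * q ^+ 2 = k%:R * q * (q - 2) by ring.
  by rewrite !mulr_ge0 ?subr_ge0 // ltW.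
have := cone_convolution_L2 H0 HZ sec_le f0.
set A := \sum_x _; set S := \sum_x _ => AS.
have -> : \sum_x real_average f x ^+ 2 = N^-1 ^+ 2 * A.
  rewrite /A mulr_sumr; apply: eq_bigr => x _.
  by rewrite real_averageE exprMn.
have S0 : 0 <= S by apply: sumr_ge0 => x _; exact: sqr_ge0.
have A_le : A <= ((q * (2 * k%:R * q) + N) / (q - 1)) ^+ 2 * S.
  rewrite expr_div_n mulrAC ler_pdivlMr ?exprn_gt0 // mulrC; exact: AS.
apply: le_trans (ler_wpM2l _ A_le) _; first by rewrite sqr_ge0.
rewrite [leLHS]mulrA -exprMn -expr_div_n ler_wpM2r //.
have N1 := N_gt0; have k0 : 0 <= k%:R :> R by rewrite ler0n.
have num0 : 0 <= q * (2 * k%:R * q) + N by rewrite addr_ge0 ?mulr_ge0 // ltW.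
rewrite ler_sqr ?nnegrE; last first.
- by rewrite divr_ge0 ?mulr_ge0 ?addr_ge0 ?invr_ge0 // ltW.
- by rewrite mulr_ge0 ?divr_ge0 // ?invr_ge0 ltW.
case/andP: HN => HN1 HN2.
have -> : D / q = (2 * k%:R + c2) * q ^+ 2 / (c1 * q ^+ 3 / 2).
  by rewrite /D; field; rewrite !gt_eqF.
rewrite mulrCA -invfM ler_pM ?invr_ge0 ?mulr_ge0 //; try exact: ltW.
  by move: HN2; lra.
rewrite lef_pV2 ?posrE ?mulr_gt0 ?exprn_gt0 ?invr_gt0 // ler_pdivrMr //.
apply: le_trans (_ : c1 * q ^+ 2 * (q - 1) * 2 <= _); last first.
  by rewrite ler_wpM2r // ler_wpM2r // ltW.
rewrite -subr_ge0.
have -> : c1 * q ^+ 2 * (q - 1) * 2 - c1 * q ^+ 3 = c1 * q ^+ 2 * (q - 2).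
  by ring.
by rewrite !mulr_ge0 ?subr_ge0 ?exprn_ge0 // ltW.
Qed.

(** The kernel of the average over [H] minus the mean over the whole space. *)
Let kernel (x y : 'rV[F]_3) : R := N^-1 * (x - y \in H)%:R - q ^- 3.

Let kernelE f x :
  \sum_y kernel x y * f y = real_average f x - q ^- 3 * \sum_y f y.
Proof.
rewrite real_averageE !mulr_sumr -sumrB; apply: eq_bigr => y _.
by rewrite mulrBl mulrAC -mulrA.
Qed.

Let kernel_le x y : `|kernel x y| <= (c1 * q ^+ 2)^-1.
Proof.
have NV : N^-1 <= (c1 * q ^+ 2)^-1.
  by rewrite lef_pV2 ?posrE ?mulr_gt0 ?exprn_gt0 //; case/andP: HN.
have q3N : q ^- 3 <= N^-1.
  rewrite lef_pV2 ?posrE ?exprn_gt0 // -natrX ler_nat.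
  by rewrite (leq_trans (max_card _)) // card_mx.
apply: le_trans NV; rewrite /kernel ler_norml.
have q3 : 0 <= q ^- 3 by rewrite invr_ge0 exprn_ge0 // ltW.
have N0 : 0 <= N^-1 by rewrite invr_ge0 ltW.
by case: (_ \in H); rewrite ?mulr1 ?mulr0; apply/andP; split; lra.
Qed.

Let kernel_L2 f :
  \sum_x (\sum_y kernel x y * f y) ^+ 2 <= D ^+ 2 / q ^+ 2 * \sum_x f x ^+ 2.
Proof.
set m := q ^- 3 * \sum_y f y.
have mE : \sum_y f y = q ^+ 3 * m by rewrite /m mulVKf // gt_eqF ?exprn_gt0.
have f0 : \sum_x (f x - m) = 0 by rewrite sumrB sum_const_space mE subrr.
have -> : \sum_x (\sum_y kernel x y * f y) ^+ 2 =
          \sum_x (real_average (fun y => f y - m) x) ^+ 2.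
  apply: eq_bigr => x _; congr (_ ^+ 2); rewrite kernelE -/m !real_averageE.
  under [in RHS]eq_bigr => y _ do rewrite mulrBl.
  rewrite sumrB -mulr_sumr sum_translate_indicator mulrBr; congr (_ - _).
  by rewrite mulrCA mulVf ?mulr1 // gt_eqF.
apply: le_trans (mean_zero_L2 f0) _; rewrite ler_wpM2l ?divr_ge0 ?sqr_ge0 //.
under eq_bigr => x _ do rewrite sqrrB.
rewrite big_split sumrB /= sum_const_space.
rewrite (_ : \sum_x (f x * m *+ 2) = 2 * (q ^+ 3 * m ^+ 2)); last first.
  under eq_bigr => x _ do rewrite -mulr_natl.
  by rewrite -mulr_sumr -mulr_suml mE -[_ * m * m]mulrA -expr2.
have : 0 <= q ^+ 3 * m ^+ 2 by rewrite mulr_ge0 ?sqr_ge0 ?exprn_ge0 // ltW.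
lra.
Qed.

(** The power mean inequality between exponents 3 and 4, through two
    applications of the Cauchy-Schwarz inequality. *)
Lemma mean_cube_le h : (forall x, 0 <= h x) ->
  (q ^- 3 * \sum_x h x ^+ 3) ^+ 4 <= (q ^- 3 * \sum_x h x ^+ 4) ^+ 3.
Proof.
move=> h0; have n0 : 0 < q ^+ 3 by rewrite exprn_gt0.
set A3 := \sum_x h x ^+ 3; set A4 := \sum_x h x ^+ 4.
set A2 := \sum_x h x ^+ 2.
have A4_ge0 : 0 <= A4 by apply: sumr_ge0 => x _; rewrite exprn_ge0.
have A3_ge0 : 0 <= A3 by apply: sumr_ge0 => x _; rewrite exprn_ge0.
have cs1 : A3 ^+ 2 <= A2 * A4.
  have := cauchy_schwarz (fun x => h x) (fun x => h x ^+ 2).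
  by congr (_ ^+ 2 <= _ * _); apply: eq_bigr => x _; rewrite -exprM.
have cs2 : A2 ^+ 2 <= q ^+ 3 * A4.
  have := cauchy_schwarz (fun _ : 'rV[F]_3 => 1) (fun x => h x ^+ 2).
  rewrite sum_const_space expr1n mulr1.
  congr (_ ^+ 2 <= _ * _); apply: eq_bigr => x _; first by rewrite mul1r.
  by rewrite -exprM.
rewrite !exprMn -ler_pdivlMl ?exprn_gt0 ?invr_gt0 // mulrA.
have -> : (q ^- 3 ^+ 4)^-1 * q ^- 3 ^+ 3 = q ^+ 3 by field; rewrite gt_eqF.
apply: le_trans (_ : (A2 * A4) ^+ 2 <= _).
  by rewrite (exprM A3 2 2) ler_sqr ?nnegrE ?sqr_ge0 ?(le_trans (sqr_ge0 _) cs1).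
rewrite exprMn (_ : q ^+ 3 * A4 ^+ 3 = q ^+ 3 * A4 * A4 ^+ 2); last by ring.
by rewrite ler_wpM2r ?sqr_ge0.
Qed.

(** The L^(4/3) -> L^4 estimate for [f = h ^+ 3], in normalized measure. *)
Lemma endpoint_estimate h : (forall x, 0 <= h x) ->
  q ^- 3 * \sum_x (real_average (fun y => h y ^+ 3) x) ^+ 4 <=
  8 * (16 * D ^+ 2 / c1 ^+ 2 + 1) * (q ^- 3 * \sum_x h x ^+ 4) ^+ 3.
Proof.
move=> h0; set m := q ^- 3 * \sum_y h y ^+ 3; set S := \sum_x h x ^+ 4.
set G := fun x => \sum_y kernel x y * h y ^+ 3.
have GE x : real_average (fun y => h y ^+ 3) x = G x + m.
  by rewrite /G (kernelE (fun y => h y ^+ 3)) subrK.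
have G4 : q ^- 3 * \sum_x G x ^+ 4 <= 16 * D ^+ 2 / c1 ^+ 2 * (q ^- 3 * S) ^+ 3.
  have := @marcinkiewicz R _ kernel (c1 * q ^+ 2)^-1 (D ^+ 2 / q ^+ 2) _ _
    kernel_le kernel_L2 h h0.
  rewrite -/S invr_gt0 mulr_gt0 ?exprn_gt0 // divr_ge0 ?sqr_ge0 // => /(_ isT isT).
  rewrite [leLHS]/= => G4; rewrite ler_pdivrMl ?exprn_gt0 //.
  apply: le_trans G4 _.
  rewrite le_eqVlt; apply/orP; left; apply/eqP; field.
  by rewrite !gt_eqF.
have pow4 (a b : R) : (a + b) ^+ 4 <= 8 * (a ^+ 4 + b ^+ 4).
  have sq (u v : R) : (u + v) ^+ 2 <= 2 * (u ^+ 2 + v ^+ 2).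
    rewrite -subr_ge0 (_ : _ - _ = (u - v) ^+ 2) ?sqr_ge0 //; ring.
  rewrite (exprM _ 2 2) (exprM a 2 2) (exprM b 2 2).
  apply: le_trans (_ : (2 * (a ^+ 2 + b ^+ 2)) ^+ 2 <= _).
    by rewrite ler_sqr ?nnegrE ?sqr_ge0 ?mulr_ge0 ?addr_ge0 ?sqr_ge0.
  by rewrite exprMn; have := sq (a ^+ 2) (b ^+ 2); lra.
have mle := mean_cube_le h0; rewrite -/m -/S in mle.
apply: le_trans (_ : q ^- 3 * \sum_x 8 * (G x ^+ 4 + m ^+ 4) <= _).
  rewrite ler_wpM2l ?invr_ge0 ?exprn_ge0 ?(ltW q_gt0) //.
  by apply: ler_sum => x _; rewrite GE.
rewrite -mulr_sumr big_split /= sum_const_space mulrCA mulrDr mulKf ?gt_eqF ?exprn_gt0 //.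
move: G4 mle; lra.
Qed.

End Endpoint.

(** * Hoelder's inequality *)

Section Hoelder.
Variable R : realType.

Lemma young_powR (a b u v : R) : 0 <= a -> 0 <= b -> a + b = 1 ->
  0 <= u -> 0 <= v -> u `^ a * v `^ b <= a * u + b * v.
Proof.
move=> a0 b0 ab u0 v0.
have [a_eq0|a_neq0] := eqVneq a 0.
  by move: ab; rewrite a_eq0 add0r => ->; rewrite powRr0 powRr1 // !mul1r mul0r add0r.
have [b_eq0|b_neq0] := eqVneq b 0.
  by move: ab; rewrite b_eq0 addr0 => ->; rewrite powRr0 powRr1 // mul0r mulr1 mul1r addr0.
have a_gt0 : 0 < a by rewrite lt_def a_neq0.
have b_gt0 : 0 < b by rewrite lt_def b_neq0.
have := @conjugate_powR R (u `^ a) (v `^ b) a^-1 b^-1.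
rewrite !powR_ge0 !invr_gt0 a_gt0 b_gt0 !invrK ab -!powRrM !mulfV // !powRr1 //.
by rewrite [u * a]mulrC [v * b]mulrC; apply.
Qed.

(** Hoelder's inequality for finite sums with conjugate exponents [a^-1] and
    [b^-1]; the extreme cases [a = 0] and [b = 0] are included because
    [x `^ 0 = 1]. *)
Lemma hoelder_sum (T : finType) (a b : R) (w u v : T -> R) :
  0 <= a -> 0 <= b -> a + b = 1 ->
  (forall x, 0 <= w x) -> (forall x, 0 <= u x) -> (forall x, 0 <= v x) ->
  \sum_x w x * (u x `^ a * v x `^ b) <=
    (\sum_x w x * u x) `^ a * (\sum_x w x * v x) `^ b.
Proof.
move=> a0 b0 ab w0 u0 v0.
have [a_eq0|a_neq0] := eqVneq a 0.
  move: ab; rewrite a_eq0 add0r => ->; rewrite powRr0 mul1r powRr1; last first.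
    by apply: sumr_ge0 => x _; rewrite mulr_ge0.
  by apply: ler_sum => x _; rewrite powRr0 mul1r powRr1.
have [b_eq0|b_neq0] := eqVneq b 0.
  move: ab; rewrite b_eq0 addr0 => ->; rewrite powRr0 mulr1 powRr1; last first.
    by apply: sumr_ge0 => x _; rewrite mulr_ge0.
  by apply: ler_sum => x _; rewrite powRr0 mulr1 powRr1.
set U := \sum_x w x * u x; set V := \sum_x w x * v x.
have U0 : 0 <= U by apply: sumr_ge0 => x _; rewrite mulr_ge0.
have V0 : 0 <= V by apply: sumr_ge0 => x _; rewrite mulr_ge0.
have vanish (t : T -> R) x : (forall x, 0 <= t x) -> \sum_x w x * t x = 0 ->
    w x * t x = 0.
  move=> t0 /eqP; rewrite psumr_eq0 => [|y _]; last by rewrite mulr_ge0.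
  by move=> /allP/(_ x (mem_index_enum _))/eqP.
have [U_eq0|U_neq0] := eqVneq U 0.
  rewrite big1 ?mulr_ge0 ?powR_ge0 // => x _.
  have /eqP := vanish u x u0 U_eq0; rewrite mulf_eq0 => /orP[/eqP ->|/eqP ->].
    by rewrite mul0r.
  by rewrite powR0 // mul0r mulr0.
have [V_eq0|V_neq0] := eqVneq V 0.
  rewrite big1 ?mulr_ge0 ?powR_ge0 // => x _.
  have /eqP := vanish v x v0 V_eq0; rewrite mulf_eq0 => /orP[/eqP ->|/eqP ->].
    by rewrite mul0r.
  by rewrite powR0 // !mulr0.
have Ugt0 : 0 < U by rewrite lt_def U_neq0.
have Vgt0 : 0 < V by rewrite lt_def V_neq0.
have -> : U `^ a * V `^ b =
    \sum_x U `^ a * V `^ b * (a * (w x * u x) / U + b * (w x * v x) / V).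
  rewrite -mulr_sumr big_split /= -!mulr_suml -!mulr_sumr -/U -/V.
  by rewrite !mulfK // ab mulr1.
apply: ler_sum => x _.
rewrite -{1}(divfK U_neq0 (u x)) -{1}(divfK V_neq0 (v x)).
rewrite (powRM a (divr_ge0 (u0 x) U0) U0) (powRM b (divr_ge0 (v0 x) V0) V0).
have y := young_powR a0 b0 ab (divr_ge0 (u0 x) U0) (divr_ge0 (v0 x) V0).
rewrite (_ : w x * ((u x / U) `^ a * U `^ a * ((v x / V) `^ b * V `^ b)) =
  U `^ a * V `^ b * (w x * ((u x / U) `^ a * (v x / V) `^ b))); last by ring.
rewrite ler_wpM2l ?mulr_ge0 ?powR_ge0 //.
apply: le_trans (ler_wpM2l (w0 x) y) _.
by rewrite le_eqVlt; apply/orP; left; apply/eqP; ring.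
Qed.

End Hoelder.

(** * Interpolation for positive averages *)

Section Interpolation.
Variables (F : finFieldType) (R : realType) (H : {set 'rV[F]_3}).
Implicit Types (f g h u v : 'rV[F]_3 -> R).

Local Notation q := (#|F|%:R : R).

(** The mean over the whole space, i.e. the integral for the normalized counting
    measure. *)
Definition mean f : R := q ^- 3 * \sum_x f x.

Let q3_gt0 : 0 < q ^+ 3.
Proof. by rewrite exprn_gt0 // ltr0n; apply/card_gt0P; exists 0. Qed.

Lemma mean_ge0 f : (forall x, 0 <= f x) -> 0 <= mean f.
Proof. by move=> f0; rewrite mulr_ge0 ?invr_ge0 ?(ltW q3_gt0) // sumr_ge0. Qed.

Lemma le_mean f g : (forall x, f x <= g x) -> mean f <= mean g.
Proof. by move=> fg; rewrite ler_wpM2l ?invr_ge0 ?(ltW q3_gt0) // ler_sum. Qed.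

Lemma mean_cst (c : R) : mean (fun=> c) = c.
Proof. by rewrite /mean sum_const_space mulKf // gt_eqF. Qed.

Lemma mean_hoelder (a b : R) u v : 0 <= a -> 0 <= b -> a + b = 1 ->
  (forall x, 0 <= u x) -> (forall x, 0 <= v x) ->
  mean (fun x => u x `^ a * v x `^ b) <= mean u `^ a * mean v `^ b.
Proof.
move=> a0 b0 ab u0 v0; rewrite /mean !mulr_sumr; exact: hoelder_sum.
Qed.

(** For a probability measure the L^r norms increase with [r]. *)
Lemma le_mean_powR (r s : R) g : 0 < r -> r <= s -> (forall x, 0 <= g x) ->
  mean (fun x => g x `^ r) `^ r^-1 <= mean (fun x => g x `^ s) `^ s^-1.
Proof.
move=> r0 rs g0; have s0 : 0 < s by exact: lt_le_trans rs.
have rs1 : r / s <= 1 by rewrite ler_pdivrMr // mul1r.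
have le1 : mean (fun x => g x `^ r) <= mean (fun x => g x `^ s) `^ (r / s).
  have -> : (fun x => g x `^ r) =
      (fun x => (g x `^ s) `^ (r / s) * 1 `^ (1 - r / s)).
    by apply/funext => x; rewrite powR1 mulr1 -powRrM mulrC divfK // gt_eqF.
  apply: le_trans (mean_hoelder _ _ _ _ _) _; rewrite ?subrKC ?subr_ge0 //.
  - by rewrite divr_ge0 // ltW.
  - by move=> x; exact: powR_ge0.
  - by rewrite mean_cst powR1 mulr1.
have -> : s^-1 = r / s * r^-1 by rewrite mulrAC mulfV ?mul1r // gt_eqF.
rewrite [leRHS]powRrM; apply: ge0_ler_powR => //.
- by rewrite invr_ge0 ltW.
- by rewrite nnegrE mean_ge0 // => x; exact: powR_ge0.
- by rewrite nnegrE powR_ge0.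
Qed.

Hypothesis H_gt0 : (0 < #|H|)%N.

Local Notation A := (real_average H).

Let N_gt0 : 0 < #|H|%:R :> R. Proof. by rewrite ltr0n. Qed.

Lemma real_average_ge0 f x : (forall x, 0 <= f x) -> 0 <= A f x.
Proof. by move=> f0; rewrite mulr_ge0 ?invr_ge0 ?(ltW N_gt0) // sumr_ge0. Qed.

Lemma real_average_cst (c : R) x : A (fun=> c) x = c.
Proof. by rewrite /real_average sumr_const -[c *+ _]mulr_natl mulKf // gt_eqF. Qed.

Lemma mean_real_average f : mean (A f) = mean f.
Proof.
rewrite /mean; congr (_ * _).
rewrite (eq_bigr (fun x => #|H|%:R^-1 * \sum_y f y * (x - y \in H)%:R))
  => [|x _]; last exact: real_averageE.
rewrite -mulr_sumr exchange_big mulr_sumr; apply: eq_bigr => y _.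
rewrite -mulr_sumr (reindex (fun x => x + y)) /=; last first.
  by exists (fun x => x - y) => x _; rewrite ?addrK ?subrK.
under eq_bigr => x _ do rewrite addrK.
rewrite sum_pred1 (@eq_card _ _ (mem H)) // mulrCA mulVf ?mulr1 // gt_eqF //.
Qed.

Lemma real_average_hoelder (a b : R) u v x : 0 <= a -> 0 <= b -> a + b = 1 ->
  (forall x, 0 <= u x) -> (forall x, 0 <= v x) ->
  A (fun x => u x `^ a * v x `^ b) x <= A u x `^ a * A v x `^ b.
Proof.
move=> a0 b0 ab u0 v0; rewrite !real_averageE !mulr_sumr.
under eq_bigr => y _ do rewrite mulrCA mulrC.
under [X in _ <= X `^ _ * _]eq_bigr => y _ do rewrite mulrCA mulrC.
under [X in _ <= _ * X `^ _]eq_bigr => y _ do rewrite mulrCA mulrC.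
by apply: hoelder_sum => // y; rewrite mulr_ge0 ?invr_ge0 ?(ltW N_gt0).
Qed.

Variable C : R.
Hypothesis C_ge1 : 1 <= C.
Hypothesis endpoint : forall h, (forall x, 0 <= h x) ->
  mean (fun x => A (fun y => h y ^+ 3) x ^+ 4) <=
    C * mean (fun x => h x ^+ 4) ^+ 3.

Let C_powR (e : R) : e <= 1 -> C `^ e <= C.
Proof. exact: ler1_powR. Qed.

(** The function to which the endpoint estimate is applied: its fourth power is
    [g `^ p]. *)
Let root4 (p : R) g x := g x `^ (p / 4).

Let root4_pow (p : R) g n x : root4 p g x ^+ n = g x `^ (p * n%:R / 4).
Proof. by rewrite /root4 -powR_mulrn ?powR_ge0 // -powRrM mulrAC. Qed.

Let root4_ge0 (p : R) g x : 0 <= root4 p g x.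
Proof. exact: powR_ge0. Qed.

(** Interpolation of the endpoint estimate with the trivial L^oo bound, on the
    edge [1/r = 1/(3p)]. *)
Lemma strong_type_low (p : R) g : 4 / 3 <= p -> (forall x, 0 <= g x) ->
  mean (fun x => A g x `^ (3 * p)) `^ (3 * p)^-1 <=
    C * mean (fun x => g x `^ p) `^ p^-1.
Proof.
move=> hp g0; have p0 : 0 < p by lra.
set h := root4 p g; have h0 x : 0 <= h x by exact: root4_ge0.
have h3_ge0 x : 0 <= h x ^+ 3 by rewrite exprn_ge0.
pose a := 4 / (3 * p).
have a0 : 0 <= a by rewrite divr_ge0 // mulr_ge0 // ltW.
have a1 : a <= 1 by rewrite ler_pdivrMr ?mulr_gt0 // mul1r; lra.
have gE : g = fun x => (h x ^+ 3) `^ a * 1 `^ (1 - a).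
  apply/funext => x; rewrite powR1 mulr1 root4_pow -powRrM.
  rewrite (_ : _ * a = 1) ?powRr1 // /a; field; rewrite gt_eqF //.
have Ag x : A g x `^ (3 * p) <= A (fun y => h y ^+ 3) x ^+ 4.
  have Ah0 : 0 <= A (fun y => h y ^+ 3) x by exact: real_average_ge0.
  rewrite -powR_mulrn // (_ : 4%:R = a * (3 * p)); last first.
    by rewrite /a divfK // gt_eqF // mulr_gt0.
  rewrite [leRHS]powRrM; apply: ge0_ler_powR.
  - by rewrite mulr_ge0 // ltW.
  - by rewrite nnegrE real_average_ge0.
  - by rewrite nnegrE powR_ge0.
  rewrite [in leLHS]gE; apply: le_trans (real_average_hoelder _ _ _ _ _ _) _ => //.
  - by rewrite subr_ge0.
  - by rewrite subrKC.
  - by rewrite real_average_cst powR1 mulr1.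
set Z := mean (fun x => g x `^ p).
have Z0 : 0 <= Z by apply: mean_ge0 => x; exact: powR_ge0.
have hZ : mean (fun x => h x ^+ 4) = Z.
  rewrite /Z; congr mean; apply/funext => x; rewrite root4_pow.
  by rewrite mulfK.
have le1 : mean (fun x => A g x `^ (3 * p)) <= C * Z ^+ 3.
  by apply: le_trans (le_mean Ag) _; rewrite -hZ; exact: endpoint.
have C0 : 0 <= C by exact: le_trans C_ge1.
apply: le_trans (_ : (C * Z ^+ 3) `^ (3 * p)^-1 <= _).
  apply: ge0_ler_powR le1.
  - by rewrite invr_ge0 mulr_ge0 // ltW.
  - by rewrite nnegrE; apply: mean_ge0 => x; exact: powR_ge0.
  - by rewrite nnegrE mulr_ge0 ?exprn_ge0.
rewrite powRM ?exprn_ge0 // -powR_mulrn // -powRrM.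
rewrite (_ : 3%:R * (3 * p)^-1 = p^-1); last by field; rewrite gt_eqF //.
rewrite ler_wpM2r ?powR_ge0 //; apply: C_powR.
by rewrite invf_le1 ?mulr_gt0 //; lra.
Qed.

(** Interpolation of the endpoint estimate with the trivial L^1 bound, on the
    edge [1/r = 3/p - 2]. *)
Lemma strong_type_high (p : R) g : 1 <= p -> p <= 4 / 3 -> (forall x, 0 <= g x) ->
  mean (fun x => A g x `^ (3 / p - 2)^-1) `^ (3 / p - 2) <=
    C * mean (fun x => g x `^ p) `^ p^-1.
Proof.
move=> p1 hp g0; have p0 : 0 < p by lra.
have pi1 : p^-1 <= 1 by rewrite invf_le1.
have pi2 : 3 / 4 <= p^-1 by rewrite -lef_pV2 ?posrE ?invr_gt0 // invrK; lra.
set h := root4 p g; have h0 x : 0 <= h x by exact: root4_ge0.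
have h3_ge0 x : 0 <= h x ^+ 3 by rewrite exprn_ge0.
have h4_ge0 x : 0 <= h x ^+ 4 by rewrite exprn_ge0.
pose a := 4 - 4 * p^-1; pose b := 4 * p^-1 - 3; pose s := (3 / p - 2)^-1.
have si0 : 0 < 3 / p - 2 by lra.
have s0 : 0 < s by rewrite invr_gt0.
have a0 : 0 <= a by rewrite /a; lra.
have b0 : 0 <= b by rewrite /b; lra.
have gE : g = fun x => (h x ^+ 3) `^ a * (h x ^+ 4) `^ b.
  apply/funext => x; rewrite !root4_pow -!powRrM.
  rewrite -powRD (_ : _ + _ = 1) ?oner_eq0 ?powRr1 //;
    rewrite /a /b; field; rewrite gt_eqF //.
pose al := a * s / 4; pose be := b * s.
have al0 : 0 <= al by rewrite /al !mulr_ge0 // ltW.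
have be0 : 0 <= be by rewrite /be mulr_ge0 // ltW.
have albe : al + be = 1.
  have -> : al + be = (3 / p - 2) * s by rewrite /al /be /a /b; field; rewrite gt_eqF.
  by rewrite mulfV // gt_eqF.
pose A3 x := A (fun y => h y ^+ 3) x; pose A4 x := A (fun y => h y ^+ 4) x.
have A3_ge0 x : 0 <= A3 x by exact: real_average_ge0.
have A4_ge0 x : 0 <= A4 x by exact: real_average_ge0.
have A34_ge0 x : 0 <= A3 x ^+ 4 by exact: exprn_ge0.
have Ag x : A g x `^ s <= (A3 x ^+ 4) `^ al * A4 x `^ be.
  apply: le_trans (_ : (A3 x `^ a * A4 x `^ b) `^ s <= _); last first.
    rewrite powRM ?powR_ge0 // -!powRrM -[A3 x ^+ 4]powR_mulrn // -powRrM.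
    by rewrite (_ : 4%:R * al = a * s) // /al; lra.
  apply: ge0_ler_powR; first exact: ltW.
  - by rewrite nnegrE real_average_ge0.
  - by rewrite nnegrE mulr_ge0 ?powR_ge0.
  rewrite [in leLHS]gE; apply: real_average_hoelder => //.
  by rewrite /a /b; lra.
set Z := mean (fun x => g x `^ p).
have Z0 : 0 <= Z by apply: mean_ge0 => x; exact: powR_ge0.
have hZ : mean (fun x => h x ^+ 4) = Z.
  rewrite /Z; congr mean; apply/funext => x; rewrite root4_pow.
  by rewrite mulfK.
have C0 : 0 <= C by exact: le_trans C_ge1.
have le1 : mean (fun x => A g x `^ s) <= (C * Z ^+ 3) `^ al * Z `^ be.
  apply: le_trans (le_mean Ag) _; apply: le_trans (mean_hoelder _ _ _ _ _) _ => //.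
  rewrite (_ : mean A4 = Z); last by rewrite /A4 mean_real_average.
  rewrite ler_wpM2r ?powR_ge0 //; apply: ge0_ler_powR => //.
  - by rewrite nnegrE; exact: mean_ge0.
  - by rewrite nnegrE mulr_ge0 ?exprn_ge0.
  - by rewrite -hZ; exact: endpoint.
rewrite -/s; apply: le_trans (_ : ((C * Z ^+ 3) `^ al * Z `^ be) `^ (3 / p - 2) <= _).
  apply: ge0_ler_powR le1; first exact: ltW.
  - by rewrite nnegrE; apply: mean_ge0 => x; exact: powR_ge0.
  - by rewrite nnegrE mulr_ge0 ?powR_ge0.
rewrite (powRM al C0 (exprn_ge0 3 Z0)) -[Z ^+ 3]powR_mulrn // -(powRrM Z).
rewrite -mulrA -powRD; last first.
  have al_be : 0 < 3%:R * al + be by move: albe al0; lra.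
  by rewrite (gt_eqF al_be).
rewrite powRM ?powR_ge0 // -!powRrM.
have sK : s * (3 / p - 2) = 1 by rewrite /s mulVf // gt_eqF.
rewrite (_ : (3%:R * al + be) * (3 / p - 2) = p^-1); last first.
  rewrite (_ : _ * _ = (3 * a / 4 + b) * (s * (3 / p - 2))).
    by rewrite sK /a /b; lra.
  by rewrite /al /be; ring.
rewrite ler_wpM2r ?powR_ge0 //; apply: C_powR.
rewrite (_ : al * _ = a / 4 * (s * (3 / p - 2))); last by rewrite /al; ring.
by rewrite sK /a; lra.
Qed.

Lemma strong_type (p r : R) g : 1 <= p -> 1 <= r ->
  p^-1 / 3 <= r^-1 -> 3 * p^-1 - 2 <= r^-1 -> (forall x, 0 <= g x) ->
  mean (fun x => A g x `^ r) `^ r^-1 <= C * mean (fun x => g x `^ p) `^ p^-1.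
Proof.
move=> p1 r1 pr1 pr2 g0; have p0 : 0 < p by lra.
have r0 : 0 < r by lra.
have Ag0 x : 0 <= A g x by exact: real_average_ge0.
have [hp|/ltW hp] := leP (4 / 3) p.
  apply: le_trans (strong_type_low hp g0); apply: le_mean_powR => //.
  by rewrite -lef_pV2 ?posrE ?mulr_gt0 // invfM mulrC.
have pi2 : 3 / 4 <= p^-1 by rewrite -lef_pV2 ?posrE ?invr_gt0 // invrK; lra.
apply: le_trans (strong_type_high p1 hp g0).
rewrite -[X in _ <= _ `^ X]invrK; apply: le_mean_powR => //.
by rewrite -lef_pV2 ?posrE ?invr_gt0 ?invrK //; lra.
Qed.

End Interpolation.

(** * Averages of complex functions *)

Section Averages.
Variables (R : realType) (F : finFieldType) (H : {set 'rV[F]_3}).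
Implicit Types (f : 'rV[F]_3 -> R[i]) (g : 'rV[F]_3 -> R).

Local Notation q := (#|F|%:R : R).
Local Notation normc := (@ComplexField.Normc.normc R).

Lemma normc_ge0 (z : R[i]) : 0 <= normc z.
Proof. by case: z => a b; exact: sqrtr_ge0. Qed.

Lemma normc_natr n : normc n%:R = n%:R.
Proof. by rewrite normcMn ComplexField.Normc.normc1. Qed.

Lemma normc_sum (I : finType) (A : {set I}) (z : I -> R[i]) :
  normc (\sum_(i in A) z i) <= \sum_(i in A) normc (z i).
Proof.
elim/big_ind2: _ => [|u a v b ua vb|i _]; last exact: lexx.
  by rewrite ComplexField.Normc.normc0.
exact: le_trans (le_normcD _ _) (lerD ua vb).
Qed.

Lemma normc_average_le f x :
  normc (average H f x) <= real_average H (fun y => normc (f y)) x.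
Proof.
rewrite /average ComplexField.Normc.normcM ComplexField.Normc.normcV normc_natr.
by rewrite ler_wpM2l ?invr_ge0 ?ler0n // normc_sum.
Qed.

Lemma le_Lpnorm_mean (r : R) f g : 0 < r -> (forall x, normc (f x) <= g x) ->
  Lpnorm r%:E f <= mean (fun x => g x `^ r) `^ r^-1.
Proof.
move=> r0 fg; have g0 x : 0 <= g x by apply: le_trans (fg x); exact: normc_ge0.
apply: ge0_ler_powR; first by rewrite invr_ge0 ltW.
- by rewrite nnegrE; apply: mean_ge0 => x; exact: powR_ge0.
- by rewrite nnegrE; apply: mean_ge0 => x; exact: powR_ge0.
apply: le_mean => x; apply: ge0_ler_powR => //; first exact: ltW.
- by rewrite nnegrE normc_ge0.
- by rewrite nnegrE.
Qed.

Hypothesis H_gt0 : (0 < #|H|)%N.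

Lemma le_average_Linfty f x :
  normc (average H f x) <= Lpnorm +oo%E f.
Proof.
apply: le_trans (normc_average_le f x) _.
rewrite -[leRHS](real_average_cst H_gt0 _ x).
rewrite ler_wpM2l ?invr_ge0 ?ler0n //; apply: ler_sum => y _.
exact: le_bigmax.
Qed.

Lemma Lpnorm_ge0 (p : \bar R) f : 0 <= Lpnorm p f.
Proof. by case: p => [p||]; rewrite ?powR_ge0 //= bigmax_ge_id. Qed.

(** The endpoint constant [C] serves at every point of the trapezium.  If [r] is
    infinite the first edge condition forces [p] to be infinite as well. *)
Lemma average_boundP (C : R) (p r : \bar R) : 1 <= C ->
  (forall h, (forall x, 0 <= h x) ->
    mean (fun x => real_average H (fun y => h y ^+ 3) x ^+ 4) <=
    C * mean (fun x => h x ^+ 4) ^+ 3) ->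
  (1 <= p)%E -> (1 <= r)%E ->
  fine p^-1%E / 3 <= fine r^-1%E -> 3 * fine p^-1%E - 2 <= fine r^-1%E ->
  average_bound H p r C.
Proof.
move=> C1 endpoint; case: p => [p||] // p1; case: r => [r||] // r1.
- rewrite !fine_invr => pr1 pr2 f; move: p1 r1; rewrite !lee_fin => p1 r1.
  apply: le_trans (strong_type H_gt0 C1 endpoint p1 r1 pr1 pr2 _); last first.
    by move=> x; exact: normc_ge0.
  apply: le_Lpnorm_mean; first exact: lt_le_trans r1.
  exact: normc_average_le.
- rewrite fine_invr invey /= => p0 _ f; exfalso.
  have : 0 < p^-1 by rewrite invr_gt0 (lt_le_trans ltr01) // -lee_fin.
  by move: p0; lra.
- move=> _ _ f; apply: le_trans (_ : Lpnorm +oo%E f <= _); last first.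
    by rewrite ler_peMl // Lpnorm_ge0.
  have r0 : 0 < r by rewrite (lt_le_trans ltr01) // -lee_fin.
  apply: le_trans (le_Lpnorm_mean r0 (le_average_Linfty f)) _.
  by rewrite mean_cst -powRrM mulfV ?gt_eqF // powRr1 // Lpnorm_ge0.
- move=> _ _ f; apply: le_trans (_ : Lpnorm +oo%E f <= _); last first.
    by rewrite ler_peMl // Lpnorm_ge0.
  apply: bigmax_le => [|x _]; first exact: Lpnorm_ge0.
  exact: le_average_Linfty.
Qed.

End Averages.

(** * Necessary conditions *)

Section Necessity.
Variables (R : realType) (F : finFieldType) (H : {set 'rV[F]_3}).
Variables (c1 c2 C : R) (p r : \bar R).

Local Notation q := (#|F|%:R : R).
Local Notation N := (#|H|%:R : R).
Local Notation normc := (@ComplexField.Normc.normc R).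

Hypotheses (c1_gt0 : 0 < c1) (HN : c1 * q ^+ 2 <= N <= c2 * q ^+ 2).
Hypotheses (C_gt0 : 0 < C) (HC : average_bound H p r C).

Let q_gt0 : 0 < q.
Proof. by rewrite ltr0n; apply/card_gt0P; exists 0. Qed.
Let q_neq0 : q != 0. Proof. by rewrite gt_eqF. Qed.
Let N_gt0 : 0 < N.
Proof. by case/andP: HN => + _; apply: lt_le_trans; rewrite mulr_gt0 ?exprn_gt0. Qed.
Let c2_gt0 : 0 < c2.
Proof.
case/andP: HN => _ /(lt_le_trans N_gt0).
by rewrite pmulr_lgt0 // exprn_gt0.
Qed.

Let q3_powR (e : R) : (q ^- 3) `^ e = q `^ (- (3 * e)).
Proof. by rewrite -powR_invn ?(ltW q_gt0) // -powRrM mulNr. Qed.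

Let density : N / q ^+ 3 <= c2 / q.
Proof.
rewrite ler_pdivrMr ?exprn_gt0 // (_ : c2 / q * q ^+ 3 = c2 * q ^+ 2).
  by case/andP: HN.
by field; rewrite gt_eqF.
Qed.

Let density_ge : c1 / q <= N / q ^+ 3.
Proof.
rewrite ler_pdivlMr ?exprn_gt0 // (_ : c1 / q * q ^+ 3 = c1 * q ^+ 2).
  by case/andP: HN.
by field; rewrite gt_eqF.
Qed.

Lemma normc_bool_powR (b : bool) (e : R) : 0 < e -> normc b%:R `^ e = b%:R.
Proof.
by move=> e0; rewrite normc_natr; case: b; rewrite ?powR1 // powR0 // gt_eqF.
Qed.

Lemma Lpnorm_ge_point (s : \bar R) (f : 'rV[F]_3 -> R[i]) x : (1 <= s)%E ->
  normc (f x) * (q ^- 3) `^ fine s^-1%E <= Lpnorm s f.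
Proof.
case: s => [s||] // s1; last first.
  by rewrite invey /= powRr0 mulr1; exact: le_bigmax.
have s0 : 0 < s by rewrite (lt_le_trans ltr01) // -lee_fin.
have nf0 := normc_ge0 (f x).
have -> : normc (f x) = (normc (f x) `^ s) `^ s^-1.
  by rewrite -powRrM mulfV ?powRr1 // gt_eqF.
rewrite fine_invr.
rewrite -powRM ?powR_ge0 ?invr_ge0 ?exprn_ge0 ?(ltW q_gt0) //.
apply: ge0_ler_powR; first by rewrite invr_ge0 ltW.
- by rewrite nnegrE mulr_ge0 ?powR_ge0 ?invr_ge0 ?exprn_ge0 ?(ltW q_gt0).
- by rewrite nnegrE; apply: mean_ge0 => z; exact: powR_ge0.
rewrite mulrC ler_wpM2l ?invr_ge0 ?exprn_ge0 ?(ltW q_gt0) //.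
by rewrite (bigD1 x) //= lerDl sumr_ge0 // => z _; exact: powR_ge0.
Qed.

(** Testing on the indicator function of [- H], whose average is [1] at [0]. *)
Lemma necessary_slope_low (s : R) : p = s%:E -> 1 <= s -> (1 <= r)%E ->
  q `^ (s^-1 - 3 * fine r^-1%E) <= C * c2 `^ s^-1.
Proof.
move=> ps s1 r1; have s0 : 0 < s by exact: lt_le_trans s1.
pose f (z : 'rV[F]_3) : R[i] := (- z \in H)%:R.
have av0 : average H f 0 = 1.
  rewrite /average /f (eq_bigr (fun=> 1)) => [|y yH].
    rewrite sumr_const mulVf // pnatr_eq0 -lt0n.
    by move: N_gt0; rewrite ltr0n.
  by rewrite sub0r opprK yH.
have := le_trans (Lpnorm_ge_point (average H f) 0 r1) (HC f).
rewrite av0 ComplexField.Normc.normc1 mul1r ps /=.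
under eq_bigr => z _ do rewrite normc_bool_powR //.
rewrite (reindex_inj (@oppr_inj _)) /=.
under eq_bigr => z _ do rewrite opprK.
rewrite sum_pred1 (@eq_card _ _ (mem H)) // q3_powR [q ^- 3 * _]mulrC => le1.
have le2 : q `^ (- (3 * fine r^-1%E)) <= C * (c2 / q) `^ s^-1.
  apply: le_trans le1 _; rewrite ler_wpM2l ?(ltW C_gt0) //.
  apply: ge0_ler_powR density; first by rewrite invr_ge0 ltW.
  - by rewrite nnegrE divr_ge0 ?exprn_ge0 // ltW.
  - by rewrite nnegrE divr_ge0 // ltW.
rewrite powRD ?q_neq0 ?implybT //.
apply: le_trans (ler_wpM2l (powR_ge0 _ _) le2) _.
rewrite powRM ?invr_ge0 ?(ltW q_gt0) ?(ltW c2_gt0) //.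
rewrite -(powR_inv1 (ltW q_gt0)) -(powRrM q) mulN1r powRN.
rewrite le_eqVlt; apply/orP; left; apply/eqP; field.
by rewrite gt_eqF // powR_gt0.
Qed.

(** Testing on the Dirac mass at the origin, whose average is the normalized
    indicator function of [H]. *)
Lemma necessary_slope_high (s t : R) : p = s%:E -> r = t%:E -> 1 <= s -> 1 <= t ->
  q `^ (3 * s^-1 - 2 - t^-1) <= C * c2 * c1 `^ (- t^-1).
Proof.
move=> ps rt s1 t1; have s0 : 0 < s by exact: lt_le_trans s1.
have t0 : 0 < t by exact: lt_le_trans t1.
pose f (z : 'rV[F]_3) : R[i] := (z == 0)%:R.
have := HC f; rewrite ps rt /=.
have -> : \sum_x normc (f x) `^ s = 1.
  rewrite (bigD1 0) //= /f eqxx ComplexField.Normc.normc1 powR1 big1 ?addr0 //.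
  by move=> z /negPf ->; rewrite ComplexField.Normc.normc0 powR0 // gt_eqF.
have -> : \sum_x normc (average H f x) `^ t = N^-1 `^ t * N.
  rewrite (eq_bigr (fun x => N^-1 `^ t * (x \in H)%:R)) => [|x _].
    by rewrite -mulr_sumr sum_pred1 (@eq_card _ _ (mem H)).
  rewrite -(normc_bool_powR (x \in H) t0) -powRM ?normc_ge0 ?invr_ge0 ?ltW //.
  congr (_ `^ _); rewrite -normc_natr -ComplexField.Normc.normcV.
  rewrite -ComplexField.Normc.normcM; congr (normc (_ * _)).
  rewrite /f big_mkcond (bigD1 x) //= subrr eqxx big1 ?addr0 => [|y yx].
    by case: (x \in H).
  by rewrite subr_eq0 eq_sym (negPf yx); case: ifP.
rewrite mulr1 q3_powR mulrCA [q ^- 3 * N]mulrC.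
rewrite (powRM _ (powR_ge0 _ _)) ?divr_ge0 ?exprn_ge0 ?(ltW q_gt0) ?(ltW N_gt0) //.
rewrite -powRrM mulfV ?gt_eqF // powRr1 ?invr_ge0 ?(ltW N_gt0) // => le1.
have le2 : N^-1 * (c1 / q) `^ t^-1 <= C * q `^ (- (3 * s^-1)).
  apply: le_trans le1; rewrite ler_wpM2l ?invr_ge0 ?(ltW N_gt0) //.
  apply: ge0_ler_powR density_ge; first by rewrite invr_ge0 ltW.
  - by rewrite nnegrE divr_ge0 // ltW.
  - by rewrite nnegrE divr_ge0 ?exprn_ge0 // ltW.
have le3 : (c1 / q) `^ t^-1 <= C * (c2 * q ^+ 2) * q `^ (- (3 * s^-1)).
  move: le2; rewrite mulrC ler_pdivrMr // mulrAC => /le_trans; apply.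
  rewrite ler_wpM2r ?powR_ge0 // ler_wpM2l ?(ltW C_gt0) //.
  by case/andP: HN.
move: le3; rewrite powRM ?invr_ge0 ?(ltW q_gt0) ?(ltW c1_gt0) //.
rewrite -(powR_inv1 (ltW q_gt0)) -powRrM mulN1r !powRD ?q_neq0 ?implybT //.
rewrite !powRN powR_mulrn ?(ltW q_gt0) //.
have E0 : 0 < q `^ (3 * s^-1) by rewrite powR_gt0.
have T0 : 0 < q `^ t^-1 by rewrite powR_gt0.
have K0 : 0 < c1 `^ t^-1 by rewrite powR_gt0.
move: (q `^ (3 * s^-1)) (q `^ t^-1) (c1 `^ t^-1) E0 T0 K0 => E T K E0 T0 K0 le3.
have w0 : 0 <= E / q ^+ 2 / K.
  by rewrite !divr_ge0 ?exprn_ge0 // ltW.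
have := ler_wpM2l w0 le3; congr (_ <= _); field.
  by rewrite !gt_eqF.
by rewrite !gt_eqF.
Qed.

End Necessity.

(** * The trapezium *)

Section Hull.
Variable R : realType.
Local Notation M := (R^o * R^o)%type.

Lemma convex_set_segment (A : set M) (u v : M) (t : R) :
  convex_set (M := M) A -> A u -> A v -> 0 <= t -> t <= 1 ->
  A (t * u.1 + (1 - t) * v.1, t * u.2 + (1 - t) * v.2).
Proof.
move=> cA Au Av t0 t1; have := cA u v (Itv01 t0 t1).
by rewrite !inE => /(_ Au Av).
Qed.

(** The trapezium with vertices [(0, 0)], [(0, 1)], [(1, 1)], [(3/4, 1/4)],
    described by its four edges. *)
Lemma convex_hull_trapezium (x y : R) :
  convex_hull (M := M) [set (0, 0); (0, 1); (1, 1); (3 / 4, 1 / 4)] (x, y) <->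
  [/\ 0 <= x, y <= 1, x / 3 <= y & 3 * x - 2 <= y].
Proof.
split=> [hull|[x0 y1 xy1 xy2] A [/= cA sA]]; last first.
  have A00 : A (0, 0) by apply: sA; left; left; left.
  have A01 : A (0, 1) by apply: sA; left; left; right.
  have A11 : A (1, 1) by apply: sA; left; right.
  have A34 : A (3 / 4, 1 / 4) by apply: sA; right.
  have Ax1 : A (x, 1).
    have := @convex_set_segment A _ _ x cA A11 A01 x0.
    by rewrite /= !(mulr1, mulr0) addr0 subrKC; apply; lra.
  (* The point of the lower boundary with abscissa [x]. *)
  have [y0 [Ay0 y0y]] : exists y0, A (x, y0) /\ y0 <= y.
    have [x34|/ltW x34] := leP x (3 / 4).
      exists (x / 3); split=> //.
      have := @convex_set_segment A _ _ (4 / 3 * x) cA A34 A00.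
      rewrite /= !mulr0 !addr0 (_ : 4 / 3 * x * (3 / 4) = x); last by field.
      by rewrite (_ : 4 / 3 * x * (1 / 4) = x / 3); [apply; lra | field].
    exists (3 * x - 2); split=> //.
    have := @convex_set_segment A _ _ (4 - 4 * x) cA A34 A11.
    rewrite /= !mulr1 (_ : _ * (3 / 4) + _ = x); last by field.
    by rewrite (_ : _ * (1 / 4) + _ = 3 * x - 2); [apply; lra | field].
  have [y_eq1|y_neq1] := eqVneq y 1; first by rewrite y_eq1.
  have y_lt1 : y < 1 by rewrite lt_def eq_sym y_neq1.
  have dy : 0 < 1 - y0 by lra.
  have := @convex_set_segment A _ _ ((1 - y) / (1 - y0)) cA Ay0 Ax1.
  rewrite /= (_ : _ * x + _ = x); last by ring.
  rewrite (_ : _ * y0 + _ = y); last by field; rewrite gt_eqF.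
  apply; first by rewrite divr_ge0 //; lra.
  by rewrite ler_pdivrMr // mul1r; lra.
apply: (hull [set z : M | [/\ 0 <= z.1, z.2 <= 1, z.1 / 3 <= z.2
  & 3 * z.1 - 2 <= z.2]]).
split=> /= [u v t|z].
  rewrite !inE /= => -[u1 u2 u3 u4] [v1 v2 v3 v4].
  have a0 : 0 <= t%:num by rewrite ge0.
  have a1 : t%:num <= 1 by rewrite le1.
  move: (t%:num) a0 a1 => a a0 a1.
  have K (s w : R) : 0 <= s -> 0 <= w -> 0 <= a * s + (1 - a) * w.
    by move=> s0 w0; rewrite addr_ge0 ?mulr_ge0 ?subr_ge0.
  have K1 := K _ _ u1 v1.
  have K2 : 0 <= a * (1 - u.2) + (1 - a) * (1 - v.2) by apply: K; lra.
  have K3 : 0 <= a * (u.2 - u.1 / 3) + (1 - a) * (v.2 - v.1 / 3).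
    by apply: K; lra.
  have K4 : 0 <= a * (u.2 - (3 * u.1 - 2)) + (1 - a) * (v.2 - (3 * v.1 - 2)).
    by apply: K; lra.
  rewrite /conv /= /GRing.scale /= /unstable.onem.
  by split; move: K1 K2 K3 K4; lra.
by case=> [[[->|->]|->]|->] /=; split; lra.
Qed.

End Hull.

(** * Uniform boundedness *)

Lemma infinite_nat_unbounded (Q : set nat) : infinite_set Q ->
  forall n, exists2 q, Q q & (n <= q)%N.
Proof.
move=> Qinf n; apply: contra_notP Qinf => Qn.
apply: (@sub_finite_set _ _ `I_n); last exact: finite_II.
by move=> q Qq; rewrite /= ltnNge; apply/negP => nq; apply: Qn; exists q.
Qed.

Lemma powR_bounded_le0 (R : realType) (Q : set nat) (e K : R) :
  infinite_set Q -> (forall q, Q q -> q%:R `^ e <= K) -> e <= 0.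
Proof.
move=> Qinf QK; rewrite leNgt; apply/negP => e0.
have [q Qq qK] := infinite_nat_unbounded Qinf (Num.bound ((`|K| + 1) `^ e^-1)).
have K1 : 0 <= `|K| + 1 by rewrite addr_ge0.
have lt1 : (`|K| + 1) `^ e^-1 < q%:R.
  apply: lt_le_trans (archi_boundP (powR_ge0 _ _)) _.
  by rewrite ler_nat.
have lt2 : `|K| + 1 <= q%:R `^ e.
  have -> : `|K| + 1 = ((`|K| + 1) `^ e^-1) `^ e.
    by rewrite -powRrM mulVf ?powRr1 // gt_eqF.
  by apply: ge0_ler_powR (ltW lt1); rewrite ?nnegrE ?powR_ge0 // ltW.
have := le_trans lt2 (QK q Qq); have := ler_norm K; lra.
Qed.

Theorem theorem5p1 (R : realType) (k : nat) (hk : (1 <= k)%N)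
  (c1 c2 : R) (hc1 : 0 < c1) (hc12 : c1 <= c2)
  (Q : set nat) (hQinf : infinite_set Q)
  (hQpp : forall q, Q q ->
     exists l n : nat, [/\ prime l, (0 < n)%N & q = (l ^ n)%N])
  (F : nat -> finFieldType) (hF : forall q, Q q -> #|F q| = q)
  (P : forall q, mpoly.mpoly 3 (F q))
  (hP : forall q, Q q -> homogeneous k (P q))
  (hcard : forall q, Q q ->
     c1 * q%:R ^+ 2 <= #|zero_set (P q)|%:R <= c2 * q%:R ^+ 2)
  (hplane : forall q, Q q -> forall m : 'rV[F q]_3, m != 0 ->
     ~~ (plane m \subset zero_set (P q)))
  (p r : \bar R) (hp : (1 <= p)%E) (hr : (1 <= r)%E) :
  (ereal_sup [set average_norm (zero_set (P q)) p r | q in Q] < +oo)%E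
  <->
  convex_hull (M := (R^o * R^o)%type)
    [set (0, 0); (0, 1); (1, 1); (3 / 4, 1 / 4)]
    (fine p^-1%E, fine r^-1%E).
Proof.
have inv01 (s : \bar R) : (1 <= s)%E -> 0 <= fine s^-1%E <= 1.
  case: s => [s||] //; last by rewrite invey /= lexx ler01.
  rewrite lee_fin fine_invr => s1; have s0 : 0 < s by exact: lt_le_trans s1.
  by rewrite invr_ge0 ltW // invf_le1.
have hcard' q : Q q -> c1 * #|F q|%:R ^+ 2 <= #|zero_set (P q)|%:R
    <= c2 * #|F q|%:R ^+ 2 by move=> Qq; rewrite hF //; exact: hcard.
rewrite convex_hull_trapezium; split=> [bounded|[_ _ edge1 edge2]].
  have [C C0 HC] : exists2 C : R, 0 < C &
      forall q, Q q -> average_bound (zero_set (P q)) p r C.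
    have [B supB] : exists B : R,
        (ereal_sup [set average_norm (zero_set (P q)) p r | q in Q] < B%:E)%E.
      move: bounded; case: ereal_sup => [s||] // _.
        by exists (s + 1); rewrite lte_fin ltrDl.
      by exists 0; exact: ltNyr.
    exists (Num.max B 1); first by rewrite lt_max ltr01 orbT.
    move=> q Qq f.
    have : (average_norm (zero_set (P q)) p r < B%:E)%E.
      apply: le_lt_trans supB; apply: ereal_sup_ubound.
      by exists q.
    move=> /ereal_inf_lt[_ [C HC <-]]; rewrite lte_fin => CB.
    apply: le_trans (HC f) _; rewrite ler_wpM2r ?Lpnorm_ge0 //.
    by rewrite le_max (ltW CB).
  have /andP[y0 y1] := inv01 r hr; have /andP[x0 x1] := inv01 p hp.
  case: p hp HC x0 x1 {bounded} => [s||] // hp HC x0 x1; last first.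
    by split=> //; move: y0; rewrite invey /=; lra.
  move: hp x0 x1; rewrite lee_fin fine_invr => hs x0 x1.
  have s0 : 0 < s by exact: lt_le_trans hs.
  have low : s^-1 - 3 * fine r^-1%E <= 0.
    apply: (powR_bounded_le0 hQinf) => q Qq; rewrite -{1}(hF q Qq).
    exact: necessary_slope_low hc1 (hcard' q Qq) C0 (HC q Qq) s erefl hs hr.
  split=> //; first by move: low; lra.
  case: r hr HC y0 y1 low => [t||] // hr HC y0 y1; last first.
    have : 0 < s^-1 by rewrite invr_gt0.
    by rewrite invey /=; lra.
  rewrite fine_invr => low.
  have : 3 * s^-1 - 2 - t^-1 <= 0.
    apply: (powR_bounded_le0 hQinf) => q Qq; rewrite -{1}(hF q Qq).
    exact: necessary_slope_high hc1 (hcard' q Qq) C0 (HC q Qq) s t erefl erefl hs hr.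
  lra.
pose D := 2 * (2 * k%:R + c2) / c1.
pose C := 8 * (16 * D ^+ 2 / c1 ^+ 2 + 1).
have C1 : 1 <= C.
  have : 0 <= 16 * D ^+ 2 / c1 ^+ 2.
    by apply: divr_ge0; [apply: mulr_ge0 |]; rewrite ?sqr_ge0 ?ler0n.
  rewrite /C; lra.
apply: (@le_lt_trans _ _ C%:E); last exact: ltry.
apply: ge_ereal_sup => _ [q Qq <-]; apply: ereal_inf_lbound.
exists C => //; have [H1 H2] := andP (hcard' q Qq).
apply: average_boundP => //.
  rewrite -(ltr0n R); apply: lt_le_trans H1; rewrite mulr_gt0 // exprn_gt0 // ltr0n.
  by apply/card_gt0P; exists 0.
move=> h h0; apply: (endpoint_estimate hc1 (hcard' q Qq)) => //.
- exact: (zero_set_origin (hP q Qq)).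
- by move=> t x; exact: (zero_set_cone (hP q Qq)).
- move=> xi xi0.
  have := card_plane_section (hP q Qq) xi0 (hplane q Qq xi xi0).
  rewrite -(ler_nat R) [((_ - _) * _)%:R]natrM [(k * _)%:R]natrM natrX natrB; last first.
    by apply/card_gt0P; exists 0.
  by rewrite /section sum_indicator.
Qed.
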